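(* For any fixed integer $\alpha\ge 1$, the problem of deciding whether a graph with stability number $\alpha$ has $\vartheta$-rank $0$ is reducible in polynomial time to the problem of deciding whether a graph with no critical edges and stability number $\alpha$ has $\vartheta$-rank $0$.
   Context: All graphs are finite and simple with nonempty vertex set. For a graph $G=(V=[n],E)$, the stability number $\alpha(G)$ is the maximum cardinality of a stable (independent) set, $A_G$ is the adjacency matrix, $I$ the identity and $J$ the all-ones matrix. An edge $e$ is critical if $\alpha(G\setminus e)=\alpha(G)+1$, where $G\setminus e$ is obtained by deleting the edge $e$. $\mathcal K_n^{(0)}$ is the set of real symmetric $n\times n$ matrices $M$ such that $\sum_{i,j=1}^n M_{ij}x_i^2x_j^2$ is a sum of squares of real polynomials. $G$ has $\vartheta$-rank $0$ if $\alpha(G)(A_G+I)-J\in\mathcal K_n^{(0)}$, and $\vartheta$-rank at least $1$ otherwise. Polynomial-time reducibility is meant in the following sense: there is an algorithm which, given a graph $G$ with $\alpha(G)=\alpha$, runs in time polynomial in the size of $G$ (with $\alpha$ fixed) and either correctly reports that $G$ has $\vartheta$-rank at least $1$, or outputs a graph $R$ with no critical edges and with $\alpha(R)=\alpha$ such that $G$ has $\vartheta$-rank $0$ if and only if $R$ has $\vartheta$-rank $0$. *)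

(* Defs.v *)
From mathcomp Require Import all_boot all_order all_algebra.
From mathcomp Require Import reals.
From mathcomp Require Import mpoly.

Set Implicit Arguments.
Unset Strict Implicit.
Unset Printing Implicit Defensive.

Import GRing.Theory.

(* [mpoly] shadows [ssrbool.symmetric], whence the qualified name below. *)

(** * Graphs *)

Record graph := Graph {
  order : nat;
  order_gt0 : 0 < order;
  adj : rel 'I_order;
  adj_sym : ssrbool.symmetric adj;
  adj_irr : irreflexive adj }.

Definition stable (G : graph) (S : {set 'I_(order G)}) : bool :=
  [forall i in S, forall j in S, ~~ adj i j].

Definition alpha (G : graph) : nat :=
  \max_(S : {set 'I_(order G)} | stable S) #|S|.

Section DeleteEdge.
Variables (G : graph) (i j : 'I_(order G)).

Definition del_edge_adj : rel 'I_(order G) :=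
  fun u v => adj u v && ([set u; v] != [set i; j]).

Lemma del_edge_sym : ssrbool.symmetric del_edge_adj.
Proof. by move=> u v; rewrite /del_edge_adj adj_sym setUC. Qed.

Lemma del_edge_irr : irreflexive del_edge_adj.
Proof. by move=> u; rewrite /del_edge_adj adj_irr. Qed.

Definition del_edge : graph :=
  Graph (order_gt0 G) del_edge_sym del_edge_irr.

End DeleteEdge.

Definition critical_edge (G : graph) (i j : 'I_(order G)) : Prop :=
  adj i j /\ alpha (del_edge i j) = (alpha G).+1.

Definition no_critical_edge (G : graph) : Prop :=
  forall i j : 'I_(order G), ~ critical_edge i j.

(** * The cone K_n^(0) and theta-rank 0 *)

Section ThetaRank.
Local Open Scope ring_scope.

Definition is_sos (R : realType) (n : nat) (p : {mpoly R[n]}) : Prop :=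
  exists s : seq {mpoly R[n]}, p = \sum_(q <- s) q ^+ 2.

Definition coneK0 (R : realType) (n : nat) (M : 'M[R]_n) : Prop :=
  M^T = M /\
  is_sos (\sum_(i < n) \sum_(j < n) M i j *: ('X_i ^+ 2 * 'X_j ^+ 2)).

Definition adj_mx (R : realType) (G : graph) : 'M[R]_(order G) :=
  \matrix_(i, j) (adj i j)%:R.

Definition theta_rank0 (R : realType) (G : graph) : Prop :=
  coneK0 ((alpha G)%:R *: (adj_mx R G + 1%:M) - const_mx 1).

End ThetaRank.

(** * Deterministic multitape Turing machines

    Tape symbols are [None] (blank) and [Some b].  A tape is two-way infinite,
    with only finitely many cells represented and all others blank.  [rhs]
    lists the cells from the scanned one rightwards, [lhs] the cells strictly
    to the left of it, nearest first. *)

Notation symbol := (option bool).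

Record tape := Tape { lhs : seq symbol; rhs : seq symbol }.

Inductive move := MoveL | MoveR | Stay.

Definition read (t : tape) : symbol := head None (rhs t).

Definition write (a : symbol) (t : tape) : tape :=
  Tape (lhs t) (a :: behead (rhs t)).

Definition shift (m : move) (t : tape) : tape :=
  match m with
  | MoveL => Tape (behead (lhs t)) (head None (lhs t) :: rhs t)
  | MoveR => Tape (read t :: lhs t) (behead (rhs t))
  | Stay => t
  end.

Record machine := Machine {
  ntapes : nat; (* there are [ntapes.+1] tapes; tape [ord0] does I/O *)
  state : finType;
  start : state;
  final : pred state;
  trans : state -> {ffun 'I_ntapes.+1 -> symbol} ->
          state * ('I_ntapes.+1 -> symbol * move) }.

Section Run.
Variable T : machine.

Definition config : Type :=
  (state T * {ffun 'I_(ntapes T).+1 -> tape})%type.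

Definition init (w : seq bool) : config :=
  (start T, [ffun k => if k == ord0 then Tape [::] (map Some w)
                       else Tape [::] [::]]).

Definition step (c : config) : config :=
  if final c.1 then c else
  let: (q, act) := trans c.1 [ffun k => read (c.2 k)] in
  (q, [ffun k => shift (act k).2 (write (act k).1 (c.2 k))]).

(* The bits from the scanned cell up to the first blank. *)
Fixpoint bits_upto_blank (s : seq symbol) : seq bool :=
  if s is Some b :: s' then b :: bits_upto_blank s' else [::].

Definition output (c : config) : seq bool :=
  bits_upto_blank (rhs (c.2 ord0)).

(* Final configurations are fixed by [step], so this says that the machine
   halts after at most [t] steps. *)
Definition computes_within (t : nat) (w v : seq bool) : Prop :=
  let c := iter t step (init w) in final c.1 /\ output c = v.

End Run.

(** * Encodings *)

(* The order in unary, a separator, the adjacency matrix row by row. *)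
Definition encode (G : graph) : seq bool :=
  nseq (order G) true ++
  false :: [seq adj i j | i <- enum 'I_(order G), j <- enum 'I_(order G)].

(* [None] is the report "theta-rank at least 1". *)
Definition encode_answer (r : option graph) : seq bool :=
  if r is Some H then true :: encode H else [:: false].

(** * Polynomial-time reduction *)

Definition correct_answer (R : realType) (a : nat) (G : graph)
    (r : option graph) : Prop :=
  match r with
  | None => ~ theta_rank0 R G
  | Some H => [/\ no_critical_edge H, alpha H = a &
                  theta_rank0 R G <-> theta_rank0 R H]
  end.

(* The behaviour of the machine is constrained only on encodings of graphs
   with stability number [a]. *)
Definition poly_time_reducible (R : realType) (a : nat) : Prop :=
  exists (T : machine) (p : {poly nat}), forall G : graph, alpha G = a ->
    exists r : option graph,
      computes_within T p.[size (encode G)]%R (encode G) (encode_answer r) /\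
      correct_answer R a G r.

(* Main.v *)
Require Import Defs.
From mathcomp Require Import all_boot all_order all_algebra.
From mathcomp Require Import reals.
From mathcomp Require Import zify ring lra mpoly.
From Stdlib Require Import FunctionalExtensionality.

(** A matrix lies in K_n^(0) iff it dominates entrywise a Gram matrix P. If G
    has theta-rank 0 with such a P below alpha (A_G + I) - J, then P annihilates
    the indicator of every maximum stable set. A critical edge ij comes with a
    set S such that S + i and S + j are both maximum stable, so i and j have the
    same Gram vector; hence whenever k is not adjacent to j, the entry P_ik =
    P_jk is at most -1 and the edge ik can be deleted without changing whether
    a Gram matrix exists. Saturating under this rule either makes a diagonal
    entry of the matrix -1, and then there is no Gram matrix at all, or turns
    every critical edge into a pair of twins. Keeping one vertex of each class
    of twins gives R: its stability number is alpha and it has no critical edge.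

    The rule is a loop nest of depth alpha + 4 whose indices all run below n,
    and so is every other pass. Hence a language having only such loops, tests
    and assignments of matrix entries suffices; a machine moving one head per
    loop variable runs it in time polynomial in n. *)

Set Implicit Arguments.
Unset Strict Implicit.
Unset Printing Implicit Defensive.

Import Order.TTheory GRing.Theory Num.Theory.

(** * Structured commands on finitely many tapes *)

(** For the indicator [x] of a maximum stable set, [x^T M x = alpha^2 - alpha^2 = 0] where
    [M = alpha (A_G + I) - J]. As [P <= M] entrywise and [x >= 0], also [x^T P x <= 0], and this is
    why [P] annihilates [x]. The existence of [P] is never decided: the algorithm handles only
    Boolean entries, and [P] lives in the correctness proof alone. One and the same family of
    vectors survives every deletion, while conversely deleting entries only lowers the bound. The
    diagonal of [A_G + I] is treated like any other entry. The rule with [k = i] clears the entry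
    [ii] as soon as [S + i + j] is an independent set of size [alpha + 1], so a diagonal that stays
    full certifies that the stability number has not grown. A pass that changes anything erases an
    entry, so [n^2] blind repetitions replace a loop with a test. This explains the depth: two loops
    for the repetition, three for [i], [j], [k], and [alpha - 1] for [S]. The depth is a constant
    only because [alpha] is fixed. *)

Definition delta (m : move) : int :=
  match m with MoveL => -1 | MoveR => 1 | Stay => 0 end%R.

Section Commands.
Variable T : finType.

(** Tapes are functions on [int] with absolute head positions, so that moving a head leaves the
    contents alone; [represents] links them to the two-list tapes of the machine model. *)
Definition env : Type := ((T -> int -> symbol) * (T -> int))%type.

Definition scan (s : env) (t : T) : symbol := s.1 t (s.2 t).

Definition perform (act : T -> symbol * move) (s : env) : env :=
  (fun t p => if p == s.2 t then (act t).1 else s.1 t p,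
   fun t => (s.2 t + delta (act t).2)%R).

Inductive cmd :=
| Act of ((T -> symbol) -> T -> symbol * move)
| Seq of cmd & cmd
| If of ((T -> symbol) -> bool) & cmd & cmd
| While of ((T -> symbol) -> bool) & cmd.

(** These control points become the states of the machine. The additional point of [If] and [While]
    is where the test is evaluated, at the price of one idle step. *)
Fixpoint control (c : cmd) : finType :=
  match c with
  | Act _ => unit
  | Seq c1 c2 => (control c1 + control c2)%type
  | If _ c1 c2 => option (control c1 + control c2)
  | While _ c1 => option (control c1)
  end.

Fixpoint entry (c : cmd) : control c :=
  match c with
  | Act _ => tt
  | Seq c1 c2 => inl (entry c1)
  | If _ c1 c2 => None
  | While _ c1 => None
  end.

Definition idle (rd : T -> symbol) (t : T) : symbol * move := (rd t, Stay).

(* [None] as a successor control point means that the command has ended. *)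
Fixpoint next (c : cmd) (rd : T -> symbol) :
    control c -> option (control c) * (T -> symbol * move) :=
  match c return control c -> option (control c) * (T -> symbol * move) with
  | Act f => fun _ => (None, f rd)
  | Seq c1 c2 => fun q =>
      match q with
      | inl q1 => let: (o, act) := next rd q1 in
                  (Some (if o is Some q1' then inl q1' else inr (entry c2)), act)
      | inr q2 => let: (o, act) := next rd q2 in (omap inr o, act)
      end
  | If b c1 c2 => fun q =>
      match q with
      | None => (Some (Some (if b rd then inl (entry c1) else inr (entry c2))),
                 idle rd)
      | Some (inl q1) =>
          let: (o, act) := next rd q1 in (omap (fun x => Some (inl x)) o, act)
      | Some (inr q2) =>
          let: (o, act) := next rd q2 in (omap (fun x => Some (inr x)) o, act)
      end
  | While b c1 => fun q =>
      match q with
      | None => (if b rd then Some (Some (entry c1)) else None, idle rd)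
      | Some q1 => let: (o, act) := next rd q1 in (Some o, act)
      end
  end.

(** [runs_last] accepts any budget [k.+1], so budgets are upper bounds and may be rounded up
    freely. *)
Inductive runs (c : cmd) : control c -> env -> nat -> env -> Prop :=
| runs_last q s k act : next (scan s) q = (None, act) ->
    runs q s k.+1 (perform act s)
| runs_step q s q' act k s' : next (scan s) q = (Some q', act) ->
    runs q' (perform act s) k s' -> runs q s k.+1 s'.

(* [exec c s k s']: from [s], [c] ends in [s'] after at most [k] steps. *)
Definition exec (c : cmd) (s : env) (k : nat) (s' : env) : Prop :=
  runs (entry c) s k s'.

Lemma runs_leq (c : cmd) (q : control c) s k k' s' :
  k <= k' -> runs q s k s' -> runs q s k' s'.
Proof.
move=> + H; elim: H k' => {q s k s'} [q s k act E|q s q' act k s' E _ IH] [|k'] //= le.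
  exact: runs_last.
by apply: runs_step E _; apply: IH.
Qed.

Lemma exec_leq c s k k' s' : k <= k' -> exec c s k s' -> exec c s k' s'.
Proof. exact: runs_leq. Qed.

Lemma perform_idle s : perform (idle (scan s)) s = s.
Proof.
case: s => F H; congr pair; last first.
  by apply: functional_extensionality => t; rewrite /= addr0.
apply: functional_extensionality => t; apply: functional_extensionality => p /=.
by case: eqP => // ->.
Qed.

Lemma exec_act f s : exec (Act f) s 1 (perform (f (scan s)) s).
Proof. exact: runs_last. Qed.

Lemma exec_seq c1 c2 s k1 s1 k2 s2 :
  exec c1 s k1 s1 -> exec c2 s1 k2 s2 -> exec (Seq c1 c2) s (k1 + k2) s2.
Proof.
rewrite /exec /=; move: (entry c1) => q H1 H2.
have {}H2: runs (inr (entry c2) : control (Seq c1 c2)) s1 k2 s2.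
  elim: H2 => {k1 s1 q H1 k2 s2} [q s1 k act E|q s1 q' act k s2 E _ IH].
    by apply: runs_last; rewrite /= E.
  by apply: runs_step IH; rewrite /= E.
elim: H1 H2 => {s k1 s1 q} [q s k act E H2|q s q' act k s1 E _ IH H2].
  rewrite addSn; apply: runs_step; first by rewrite /= E.
  by apply: runs_leq H2; rewrite leq_addl.
rewrite addSn; apply: (@runs_step _ _ _ (inl q' : control (Seq c1 c2)) act).
  by rewrite /= E.
exact: IH.
Qed.

Lemma exec_if (b : (T -> symbol) -> bool) c1 c2 s k s' :
  exec (if b (scan s) then c1 else c2) s k s' -> exec (If b c1 c2) s k.+1 s'.
Proof.
move=> H; apply: runs_step => //=; rewrite perform_idle.
case: (b (scan s)) H; rewrite /exec /=.
  move: (entry c1) => q; elim=> {q s k s'} [q s k act E|q s q' act k s' E _ IH].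
    by apply: runs_last; rewrite /= E.
  by apply: runs_step IH; rewrite /= E.
move: (entry c2) => q; elim=> {q s k s'} [q s k act E|q s q' act k s' E _ IH].
  by apply: runs_last; rewrite /= E.
by apply: runs_step IH; rewrite /= E.
Qed.

Lemma exec_while_false (b : (T -> symbol) -> bool) c s : ~~ b (scan s) -> exec (While b c) s 1 s.
Proof.
move=> nb; rewrite -{2}[s]perform_idle; apply: runs_last => /=.
by rewrite (negPf nb).
Qed.

Lemma exec_while_true (b : (T -> symbol) -> bool) c s k1 s1 k2 s2 : b (scan s) ->
  exec c s k1 s1 -> exec (While b c) s1 k2 s2 ->
  exec (While b c) s (k1 + k2).+1 s2.
Proof.
move=> bs H1 H2; apply: runs_step; first by rewrite /= bs.
rewrite perform_idle; move: H1; rewrite /exec; move: (entry c) => q H1.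
elim: H1 H2 => {s k1 s1 q bs} [q s k act E H2|q s q' act k s1 E _ IH H2].
  rewrite addSn; apply: runs_step; first by rewrite /= E.
  by apply: runs_leq H2; rewrite leq_addl.
rewrite addSn; apply: (@runs_step _ _ _ (Some q' : control (While b c)) act).
  by rewrite /= E.
exact: IH.
Qed.

(** [S i] is the environment at the [i]-th test; a loop is verified by giving this trajectory in
    closed form. *)
Lemma exec_while (b : (T -> symbol) -> bool) c m k (S : nat -> env) :
  (forall i, i < m -> b (scan (S i)) /\ exec c (S i) k (S i.+1)) ->
  ~~ b (scan (S m)) -> exec (While b c) (S 0) (m * k.+1).+1 (S m).
Proof.
elim: m S => [|m IH] S HS Hm; first exact: exec_while_false.
have [b0 e0] := HS 0 isT.
apply: exec_leq (exec_while_true b0 e0 (IH (fun i => S i.+1) _ Hm)); first lia.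
by move=> i lim; apply: HS.
Qed.

End Commands.

(** * From commands to Turing machines *)

Section Compilation.
Variables (T : finType) (c : cmd (option T)).

(** [None] has to be the tape [ord0], on which the machine reads its input and leaves its output. *)
Definition tape_name (k : 'I_#|T|.+1) : option T :=
  omap enum_val (unlift ord0 k).

Definition tape_index (t : option T) : 'I_#|T|.+1 :=
  if t is Some t then lift ord0 (enum_rank t) else ord0.

Lemma tape_indexK : cancel tape_index tape_name.
Proof.
by case=> [t|]; rewrite /tape_name /= ?unlift_none ?liftK //= enum_rankK.
Qed.

Lemma tape_nameK : cancel tape_name tape_index.
Proof.
move=> k; rewrite /tape_name; case: unliftP => [j ->|->] //=.
by rewrite enum_valK.
Qed.

Definition compiled : machine :=
  @Machine #|T| (option (control c)) (Some (entry c)) (fun q => q == None)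
    (fun q rd => match q with
     | Some q => let: (o, act) := next (fun t => rd (tape_index t)) q in
                 (o, fun k => act (tape_name k))
     | None => (None, fun k => (rd k, Stay))
     end).

(** Reading past the end of a list yields a blank, so trailing blanks in the lists are
    immaterial. *)
Definition represents (t : tape) (f : int -> symbol) (h : int) : Prop :=
  forall i : nat, nth None (rhs t) i = f (h + i%:Z)%R /\
                  nth None (lhs t) i = f (h - 1 - i%:Z)%R.

Lemma represents_read t f h : represents t f h -> read t = f h.
Proof. by move=> /(_ 0) [+ _]; rewrite addr0 => <-; case: t => l []. Qed.

Lemma represents_act t f h a m : represents t f h ->
  represents (shift m (write a t)) (fun p => if p == h then a else f p)
    (h + delta m)%R.
Proof.
case: t => l r H.
have Hr i : nth None (a :: behead r) i =
    if (h + i%:Z == h)%R then a else f (h + i%:Z)%R.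
  case: i => [|i] /=; first by rewrite addr0 eqxx.
  case: eqP => [|_]; first lia.
  by have [/= <- _] := H i.+1; case: (r) => //=; rewrite nth_nil.
have Hl i : nth None l i =
    if (h - 1 - i%:Z == h)%R then a else f (h - 1 - i%:Z)%R.
  case: eqP => [|_]; first lia.
  by have [_ /= <-] := H i.
case: m => i /=.
- split.
    case: i => [|i] /=; last by rewrite -/(nth None (a :: behead r) i) Hr; congr (if _ == _ then _ else f _); lia.
    by rewrite -nth0 Hl; congr (if _ == _ then _ else f _); lia.
  by rewrite nth_behead Hl; congr (if _ == _ then _ else f _); lia.
- split.
    by rewrite -[behead r]/(behead (a :: behead r)) nth_behead Hr; congr (if _ == _ then _ else f _); lia.
  case: i => [|i] /=.
    by rewrite ifT //; apply/eqP; lia.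
  by rewrite Hl; congr (if _ == _ then _ else f _); lia.
- by rewrite addr0 Hr Hl.
Qed.

Definition simulates (tp : {ffun 'I_#|T|.+1 -> tape}) (s : env (option T)) :=
  forall k, represents (tp k) (s.1 (tape_name k)) (s.2 (tape_name k)).

Lemma iter_step_final n (x : config compiled) :
  final x.1 -> iter n (@step compiled) x = x.
Proof. by move=> fx; elim: n => //= n ->; rewrite /step fx. Qed.

Lemma compiled_runs q s k s' (tp : {ffun 'I_#|T|.+1 -> tape}) :
  runs q s k s' -> simulates tp s ->
  exists2 tp' : {ffun 'I_#|T|.+1 -> tape},
    iter k (@step compiled) (Some q, tp) = (None, tp') & simulates tp' s'.
Proof.
move=> H; elim: H tp => {q s k s'} [q s k act E|q s q' act k s' E _ IH] tp Htp.
all: have Erd : (fun t => [ffun j => read (tp j)] (tape_index t)) = scan s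
       by apply: functional_extensionality => t;
          rewrite ffunE (represents_read (Htp _)) tape_indexK.
all: pose tp1 := [ffun j => shift (act (tape_name j)).2
                    (write (act (tape_name j)).1 (tp j))].
all: have Htp1 : simulates tp1 (perform act s)
       by move=> j; rewrite /tp1 ffunE; apply: represents_act.
(* The budget may exceed the actual running time; the surplus iterations stay in the final state. *)
- exists tp1 => //; rewrite iterSr {2}/step /= Erd E.
  exact: (@iter_step_final _ (None, tp1)).
- have [tp' E' Htp'] := IH tp1 Htp1.
  by exists tp' => //; rewrite iterSr {2}/step /= Erd E.
Qed.

Definition input_env (w : seq bool) : env (option T) :=
  (fun t p => if (t == None) && (0 <= p)%R then nth None (map Some w) `|p|
              else None, fun=> 0%R).

Lemma compiled_correct w v k s : exec c (input_env w) k s ->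
  (forall i, s.1 None (s.2 None + i%:Z)%R = nth None (map Some v) i) ->
  computes_within compiled k w v.
Proof.
move=> H Hs; rewrite /computes_within /init.
set tp := (X in (start _, X)).
have Htp : simulates tp (input_env w).
  move=> j i; rewrite /tp ffunE -[j in j == _]tape_nameK /=.
  case: (tape_name j) => [t|] /=; first by rewrite nth_nil.
  by rewrite nth_nil ifF //; lia.
have [tp' -> Htp'] := compiled_runs H Htp; split=> //=.
rewrite /output /=.
have {}Htp' i : nth None (rhs (tp' ord0)) i = nth None (map Some v) i.
  by have [-> _] := Htp' ord0 i; rewrite /tape_name unlift_none Hs.
elim: (rhs (tp' ord0)) v Htp' {Hs H s k tp Htp} => [|a r IH] [|b v] //= E.
- by have := E 0.
- by have /= -> := E 0.
- by have /= -> := E 0; rewrite (IH v) // => i; apply: (E i.+1).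
Qed.

End Compilation.

(** * Loop programs on two matrices *)

Section Moving.
Variable T : finType.
Implicit Types (F : T -> int -> symbol) (H : T -> int).

Definition slide (P : pred T) (m : move) : cmd T :=
  Act (fun rd t => (rd t, if P t then m else Stay)).

Definition put (u : T) (b : symbol) : cmd T :=
  Act (fun rd t => (if t == u then b else rd t, Stay)).

(** All tapes of [P] move in lockstep with [u], stopped by the blank of [u] at position -1. The
    first move is unconditional because [u] may stand on the blank just after its data. *)
Definition home (P : pred T) (u : T) : cmd T :=
  Seq (slide P MoveL)
 (Seq (While (fun rd => rd u != None) (slide P MoveL)) (slide P MoveR)).

Lemma exec_slide (P : pred T) m F H : exec (slide P m) (F, H) 1
  (F, fun t => if P t then (H t + delta m)%R else H t).
Proof.
rewrite [X in exec _ _ _ X](_ : _ =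
  perform (fun t => (scan (F, H) t, if P t then m else Stay)) (F, H)).
  exact: exec_act.
congr pair; apply: functional_extensionality => t /=.
  by apply: functional_extensionality => p; rewrite /scan; case: eqP => // ->.
by case: (P t); rewrite ?addr0.
Qed.

Lemma exec_put u b F H : exec (put u b) (F, H) 1
  (fun t p => if (t == u) && (p == H u) then b else F t p, H).
Proof.
rewrite [X in exec _ _ _ X](_ : _ =
  perform (fun t => (if t == u then b else scan (F, H) t, Stay)) (F, H)).
  exact: exec_act.
congr pair; apply: functional_extensionality => t /=; last by rewrite addr0.
apply: functional_extensionality => p; rewrite /scan /=.
by case: (eqVneq t u) => [->|_] //=; case: eqP => // ->.
Qed.

Lemma exec_home (P : pred T) u F H (h : nat) : P u -> H u = h ->
  (forall i, i < h -> F u i != None) -> F u (-1)%R = None ->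
  exec (home P u) (F, H) (h.*2 + 3)
    (F, fun t => if P t then (H t - h%:Z)%R else H t).
Proof.
move=> Pu Hu Fh F1.
pose S (i : nat) : env T :=
  (F, fun t => if P t then (H t - 1 - i%:Z)%R else H t).
have E1 : exec (slide P MoveL) (F, H) 1 (S 0).
  rewrite [S 0](_ : _ = (F, fun t => if P t then (H t + delta MoveL)%R else H t)).
    exact: exec_slide.
  by congr pair; apply: functional_extensionality => t; case: ifP => // _; rewrite /=; lia.
have E2 : exec (While (fun rd => rd u != None) (slide P MoveL)) (S 0) (h * 2).+1 (S h).
  apply: (exec_while (k := 1)).
    move=> i ih; split.
      rewrite /scan /= Pu Hu (_ : h%:Z - 1 - i%:Z = (h - i.+1)%N)%R; last lia.
      by apply: Fh; lia.
    rewrite [S i.+1](_ : _ = (F, fun t => if P t then ((S i).2 t + delta MoveL)%R else (S i).2 t)).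
      exact: exec_slide.
    by congr pair; apply: functional_extensionality => t /=; case: ifP => // _; lia.
  rewrite /scan /= Pu Hu (_ : h%:Z - 1 - h%:Z = -1)%R; last lia.
  by rewrite F1.
have E3 : exec (slide P MoveR) (S h) 1
    (F, fun t => if P t then (H t - h%:Z)%R else H t).
  rewrite [X in exec _ _ _ (_, X)](_ : _ =
    (fun t => if P t then ((S h).2 t + delta MoveR)%R else (S h).2 t)).
    exact: exec_slide.
  by apply: functional_extensionality => t /=; case: ifP => // _; lia.
by apply: exec_leq (exec_seq E1 (exec_seq E2 E3)); lia.
Qed.

End Moving.

(** Matrix [true] holds the graph and matrix [false] is scratch space. Every loop has exactly [n]
    turns, so a polynomial time bound can be read off the syntax by recursion. *)
Inductive prog :=
| PSkip
| PSeq of prog & prog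
| PFor of prog
| PIf of bool & nat & nat & prog & prog
| PSet of bool & nat & nat & bool
| PEmit of bool.

Record store := Store { mat : bool -> nat -> nat -> bool; out : seq bool }.

Definition set_mat (q : bool) (i j : nat) (b : bool) (s : store) : store :=
  Store (fun q' i' j' => if [&& q' == q, i' == i & j' == j] then b
                         else mat s q' i' j') (out s).

Definition emit (b : bool) (s : store) : store := Store (mat s) (rcons (out s) b).

(* Variables are de Bruijn levels: [PFor] binds the level [size r] to the
   successive values below [n]; unbound levels have the value [0]. *)
Fixpoint den (n : nat) (r : seq nat) (c : prog) (s : store) : store :=
  match c with
  | PSkip => s
  | PSeq c1 c2 => den n r c2 (den n r c1 s)
  | PFor c => foldl (fun s i => den n (rcons r i) c s) s (iota 0 n)
  | PIf q x y c1 c2 =>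
      if mat s q (nth 0 r x) (nth 0 r y) then den n r c1 s else den n r c2 s
  | PSet q x y b => set_mat q (nth 0 r x) (nth 0 r y) b s
  | PEmit b => emit b s
  end.

(** * Implementing loop programs by commands *)

Section Prog.
Variable K : nat.

(* The tape [None] does the output, the tapes [inl q] hold the two matrices
   row by row, and each variable is the position of the head on a tape [inr x]
   carrying [n] ones. *)
Notation Tp := (option (bool + 'I_K.+1)).

Definition mtape (q : bool) : Tp := Some (inl q).
Definition vtape (x : nat) : Tp := Some (inr (inord x)).

(** The strict bounds keep level [K] free: the head of that tape always rests at 0, and the tape
    serves as a ruler of length [n]. *)
Fixpoint wf (d : nat) (c : prog) : bool :=
  match c with
  | PSkip | PEmit _ => true
  | PSeq c1 c2 => wf d c1 && wf d c2
  | PFor c => (d < K) && wf d.+1 c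
  | PIf _ x y c1 c2 => [&& x < K, y < K, wf d c1 & wf d c2]
  | PSet _ x y _ => (x < K) && (y < K)
  end.

(* Runs [c] as many times as the value of the variable [x]: the current
   position is marked, and the head comes back to the mark from the left. *)
Definition along (x : nat) (c : cmd Tp) : cmd Tp :=
  Seq (put (vtape x) (Some false))
 (Seq (home (pred1 (vtape x)) (vtape x))
 (Seq (While (fun rd => rd (vtape x) == Some true)
         (Seq c (slide (pred1 (vtape x)) MoveR)))
      (put (vtape x) (Some true)))).

(** One row down in matrix [q]: its head advances by the [n] cells measured on the ruler tape [K],
    so no arithmetic on positions is needed. *)
Definition stride (q : bool) : cmd Tp :=
  Seq (While (fun rd => rd (vtape K) == Some true)
         (slide (pred2 (mtape q) (vtape K)) MoveR))
      (home (pred1 (vtape K)) (vtape K)).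

Definition seek (q : bool) (x y : nat) : cmd Tp :=
  Seq (along x (stride q)) (along y (slide (pred1 (mtape q)) MoveR)).

Definition mhome (q : bool) : cmd Tp := home (pred1 (mtape q)) (mtape q).

(** Between commands each matrix head rests on cell 0, hence the [mhome] at the start of both
    branches. The head of tape [d] is itself the loop counter, and the loop stops on the blank after
    the [n] ones. *)
Fixpoint code (d : nat) (c : prog) : cmd Tp :=
  match c with
  | PSkip => slide pred0 Stay
  | PSeq c1 c2 => Seq (code d c1) (code d c2)
  | PFor c => Seq (While (fun rd => rd (vtape d) == Some true)
                     (Seq (code d.+1 c) (slide (pred1 (vtape d)) MoveR)))
                  (home (pred1 (vtape d)) (vtape d))
  | PIf q x y c1 c2 => Seq (seek q x y)
      (If (fun rd => rd (mtape q) == Some true)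
         (Seq (mhome q) (code d c1)) (Seq (mhome q) (code d c2)))
  | PSet q x y b => Seq (seek q x y) (Seq (put (mtape q) (Some b)) (mhome q))
  | PEmit b => Seq (put None (Some b)) (slide (pred1 None) MoveR)
  end.

Definition contents (n : nat) (s : store) (t : Tp) (p : int) : symbol :=
  match t with
  | None => if (0 <= p)%R then nth None (map Some (out s)) `|p| else None
  | Some (inl q) => if ((0 <= p) && (p < (n * n)%:Z))%R
                    then Some (mat s q (`|p| %/ n) (`|p| %% n)) else None
  | Some (inr _) => if ((0 <= p) && (p < n%:Z))%R then Some true else None
  end.

Definition heads (r : seq nat) (s : store) (t : Tp) : int :=
  match t with
  | None => size (out s)
  | Some (inl _) => 0%R
  | Some (inr x) => nth 0 r x
  end.

Definition rep n r s : env Tp := (contents n s, heads r s).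

Definition hset (H : Tp -> int) (u : Tp) (h : int) : Tp -> int :=
  fun t => if t == u then h else H t.

(** [G i] gives the heads after [i] turns. During the turns the mark occupies cell [v] of tape [x],
    so [c] has to work with the altered contents [F']. Bounding [v] by [n] makes the budget
    independent of the value of the variable. *)
Lemma exec_along x c (F : Tp -> int -> symbol) (H : Tp -> int) (G : nat -> Tp -> int) v n k :
  F (vtape x) = (fun p => if ((0 <= p) && (p < n%:Z))%R then Some true else None) ->
  v < n -> H (vtape x) = Posz v -> G 0 = H ->
  (forall i, i < v ->
     let F' (t : Tp) (p : int) := if (t == vtape x) && (p == v) then Some false else F t p in
     exec c (F', hset (G i) (vtape x) i) k (F', hset (G i.+1) (vtape x) i)) ->
  exec (along x c) (F, H) (6 + n * (k + 4)) (F, hset (G v) (vtape x) v).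
Proof.
move=> Fx vn Hx G0 Hc.
pose F' t p := if (t == vtape x) && (p == Posz v) then Some false else F t p.
pose S i : env Tp := (F', hset (G i) (vtape x) i).
have E1 : exec (put (vtape x) (Some false)) (F, H) 1 (F', H).
  by rewrite /F' -Hx; apply: exec_put.
have E2 : exec (home (pred1 (vtape x)) (vtape x)) (F', H) (v.*2 + 3) (S 0).
  rewrite /S G0 [hset _ _ _](_ : _ =
    (fun t => if pred1 (vtape x) t then (H t - v%:Z)%R else H t)); last first.
    apply: functional_extensionality => t; rewrite /hset /=.
    by case: eqP => // ->; rewrite Hx subrr.
  apply: exec_home; rewrite /= ?eqxx //.
    move=> i iv; rewrite /F' eqxx ifF ?Fx ?ifT //; lia.
  by rewrite /F' eqxx /= Fx.
have E3 : exec (While (fun rd => rd (vtape x) == Some true)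
         (Seq c (slide (pred1 (vtape x)) MoveR))) (S 0) (v * (k + 1).+1).+1 (S v).
  apply: exec_while.
    move=> i iv; split.
      rewrite /scan /= /hset eqxx /F' eqxx /= ifF ?Fx ?ifT //; lia.
    apply: exec_seq (Hc i iv) _.
    rewrite /S [hset (G i.+1) _ i.+1](_ : _ = (fun t => if pred1 (vtape x) t then
       (hset (G i.+1) (vtape x) i t + delta MoveR)%R else hset (G i.+1) (vtape x) i t)).
      exact: exec_slide.
    apply: functional_extensionality => t; rewrite /hset /=.
    by case: eqP => // _; lia.
  by rewrite /scan /= /hset eqxx /F' !eqxx.
have E4 : exec (put (vtape x) (Some true)) (S v) 1 (F, hset (G v) (vtape x) v).
  rewrite [F in X in exec _ _ _ X](_ : _ = fun t p =>
     if (t == vtape x) && (p == hset (G v) (vtape x) v (vtape x)) then Some true else F' t p).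
    exact: exec_put.
  apply: functional_extensionality => t; apply: functional_extensionality => p.
  rewrite /hset eqxx /F'; case: eqP => //= ->; case: eqP => //= ->.
  by rewrite Fx ifT //; lia.
apply: exec_leq (exec_seq E1 (exec_seq E2 (exec_seq E3 E4))).
nia.
Qed.

Lemma exec_stride q (F : Tp -> int -> symbol) (H : Tp -> int) (h : int) n :
  F (vtape K) = (fun p => if ((0 <= p) && (p < n%:Z))%R then Some true else None) ->
  H (vtape K) = 0%R -> H (mtape q) = h ->
  exec (stride q) (F, H) (4 * n + 4) (F, hset H (mtape q) (h + n%:Z)%R).
Proof.
move=> Fx Hx Hq.
pose S (i : nat) : env Tp := (F, fun t => if pred2 (mtape q) (vtape K) t
   then (H t + i%:Z)%R else H t).
have E1 : exec (While (fun rd => rd (vtape K) == Some true)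
         (slide (pred2 (mtape q) (vtape K)) MoveR)) (S 0) (n * 2).+1 (S n).
  apply: exec_while.
    move=> i iv; split.
      rewrite /scan /= ?eqxx ?orbT Hx Fx ifT //; lia.
    rewrite [S i.+1](_ : _ = (F, fun t => if pred2 (mtape q) (vtape K) t then
       ((S i).2 t + delta MoveR)%R else (S i).2 t)).
      exact: exec_slide.
    congr pair; apply: functional_extensionality => t; rewrite /=.
    by case: ifP => // _; lia.
  by rewrite /scan /= ?eqxx ?orbT Hx Fx ifF //; lia.
have S0 : S 0 = (F, H).
  congr pair; apply: functional_extensionality => t.
  by case: ifP => //; rewrite addr0.
rewrite S0 in E1.
have E2 : exec (home (pred1 (vtape K)) (vtape K)) (S n) (n.*2 + 3)
    (F, hset H (mtape q) (h + n%:Z)%R).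
  rewrite [hset _ _ _](_ : _ =
    (fun t => if pred1 (vtape K) t then ((S n).2 t - n%:Z)%R else (S n).2 t)).
    apply: exec_home; rewrite /= ?eqxx //.
    - by rewrite Hx add0r.
    - by move=> i iv; rewrite Fx ifT //; lia.
    - by rewrite Fx.
  apply: functional_extensionality => t; rewrite /hset /=.
  case: (eqVneq t (vtape K)) => [->|_] /=; first by rewrite Hx; lia.
  by rewrite orbF; case: eqP => // ->; rewrite Hq.
by apply: exec_leq (exec_seq E1 E2); lia.
Qed.

Lemma vtape_eq x y : x <= K -> y <= K -> (vtape x == vtape y) = (x == y).
Proof.
move=> xK yK; apply/eqP/eqP => [[/(congr1 val)]|-> //] /=.
by rewrite !inordK.
Qed.

Lemma heads_vtape r s x : x <= K -> heads r s (vtape x) = nth 0 r x.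
Proof. by move=> xK; rewrite /heads /vtape inordK. Qed.

(** The sum of two bounds for [along]: [6 + n (4 n + 8)] for going down by strides, [6 + 5 n] for
    going along the row. *)
Definition seek_cost : {poly nat} := (12%N%:P + 13%N%:P * 'X + 4%N%:P * 'X * 'X)%R.

Lemma exec_seek n r s q x y : 0 < n -> size r <= K -> all (gtn n) r ->
  x < K -> y < K ->
  exec (seek q x y) (rep n r s) (seek_cost.[n])%R
   (contents n s, hset (heads r s) (mtape q) (nth 0 r x * n + nth 0 r y)%N).
Proof.
move=> n0 rK rn xK yK.
have nthn z : nth 0 r z < n.
  case: (ltnP z (size r)) => zr; last by rewrite nth_default.
  by apply: (allP rn); rewrite mem_nth.
have zK : nth 0 r K = 0 by rewrite nth_default.
set i := nth 0 r x; set j := nth 0 r y.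
pose H1 (m : nat) := hset (heads r s) (mtape q) m.
have E1 : exec (along x (stride q)) (rep n r s) (6 + n * ((4 * n + 4) + 4))
     (contents n s, H1 (i * n)%N).
  rewrite [H1 _](_ : _ = hset (H1 (i * n)%N) (vtape x) i); last first.
    apply: functional_extensionality => t; rewrite /hset.
    case: eqP => // ->; rewrite /H1 /hset /=.
    by rewrite -[LHS]/(heads r s (vtape x)) heads_vtape // ltnW.
  apply: (@exec_along x (stride q) _ _ (fun l => H1 (l * n)%N) i n) => //.
  - exact: nthn.
  - by rewrite heads_vtape // ltnW.
  - apply: functional_extensionality => t; rewrite /H1 /hset.
    by case: eqP => // ->.
  move=> l li /=.
  rewrite [X in exec _ _ _ (_, X)](_ : _ =
     hset (hset (H1 (l * n)%N) (vtape x) l) (mtape q) (Posz (l * n)%N + Posz n)%R).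
    apply: exec_stride.
    - apply: functional_extensionality => p.
      by rewrite vtape_eq ?(ltnW xK) // gtn_eqF.
    - by rewrite /hset vtape_eq ?(ltnW xK) // gtn_eqF //= -[LHS]/(heads r s (vtape K)) heads_vtape // zK.
    - by rewrite /hset /= /H1 /hset eqxx.
  apply: functional_extensionality => t; rewrite /H1 /hset.
  case: (eqVneq t (vtape x)) => [->|_] //=; case: eqP => // _; lia.
have E2 : exec (along y (slide (pred1 (mtape q)) MoveR)) (contents n s, H1 (i * n)%N)
    (6 + n * (1 + 4)) (contents n s, H1 (i * n + j)%N).
  rewrite [H1 (i * n + j)%N](_ : _ = hset (H1 (i * n + j)%N) (vtape y) j); last first.
    apply: functional_extensionality => t; rewrite /hset.
    case: eqP => // ->; rewrite /H1 /hset /=.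
    by rewrite -[LHS]/(heads r s (vtape y)) heads_vtape // ltnW.
  apply: (@exec_along y _ _ _ (fun l => H1 (i * n + l)%N) j n) => //.
  - exact: nthn.
  - by rewrite /H1 /hset /= -[LHS]/(heads r s (vtape y)) heads_vtape // ltnW.
  - by rewrite addn0.
  move=> l li /=.
  rewrite [X in exec _ _ _ (_, X)](_ : _ =
    (fun t => if pred1 (mtape q) t then (hset (H1 (i * n + l)%N) (vtape y) l t + delta MoveR)%R
      else hset (H1 (i * n + l)%N) (vtape y) l t)).
    exact: exec_slide.
  apply: functional_extensionality => t; rewrite /H1 /hset /=.
  case: (eqVneq t (vtape y)) => [->|_] //=; case: eqP => // _; lia.
apply: exec_leq (exec_seq E1 E2).
rewrite /seek_cost !hornerD !hornerMX !hornerC. nia.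
Qed.

Definition mhome_cost : {poly nat} := (2%N%:P * 'X * 'X + 3%N%:P)%R.

(** In [PFor], the 4 per turn pays the test, the advance, and two steps of the way home; the
    constant 4 is the last test and the overhead 3 of [home]. Natural coefficients make evaluation
    monotone in [n]. *)
Fixpoint cost (c : prog) : {poly nat} :=
  match c with
  | PSkip => 1%N%:P
  | PSeq c1 c2 => cost c1 + cost c2
  | PFor c => (cost c + 4%N%:P) * 'X + 4%N%:P
  | PIf _ _ _ c1 c2 => seek_cost + (mhome_cost + cost c1 + cost c2 + 1%N%:P)
  | PSet _ _ _ _ => seek_cost + (1%N%:P + mhome_cost)
  | PEmit _ => 2%N%:P
  end%R.

Lemma exec_mhome n r s q i j : i < n -> j < n ->
  exec (mhome q) (contents n s, hset (heads r s) (mtape q) (i * n + j)%N)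
    (mhome_cost.[n])%R (rep n r s).
Proof.
move=> ni nj; have ij : i * n + j < n * n by nia.
have E : exec (mhome q) (contents n s, hset (heads r s) (mtape q) (i * n + j)%N)
    ((i * n + j).*2 + 3) (rep n r s).
  rewrite [rep n r s](_ : _ = (contents n s, fun t => if pred1 (mtape q) t then
    (hset (heads r s) (mtape q) (i * n + j)%N t - Posz (i * n + j)%N)%R
    else hset (heads r s) (mtape q) (i * n + j)%N t)).
    apply: exec_home; rewrite /= /hset ?eqxx //.
    by move=> l lij; rewrite ifT //; lia.
  congr pair; apply: functional_extensionality => t; rewrite /hset /=.
  by case: eqP => // ->; rewrite subrr.
apply: exec_leq E; rewrite /mhome_cost !hornerD !hornerMX !hornerC; lia.
Qed.

Lemma contents_mtape n s q i j : i < n -> j < n ->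
  contents n s (mtape q) (i * n + j)%N = Some (mat s q i j).
Proof.
move=> ni nj; have ij : i * n + j < n * n by nia.
rewrite /= ifT; last lia.
by rewrite divnMDl ?divn_small ?modnMDl ?modn_small ?addn0 //; lia.
Qed.

Lemma eq_cell (n i j : nat) (p : int) : j < n -> (0 <= p)%R ->
  (p == Posz (i * n + j)) = (`|p| %/ n == i) && (`|p| %% n == j).
Proof.
case: p => // p jn _; rewrite absz_nat eqz_nat.
apply/eqP/andP => [->|[/eqP<- /eqP<-]]; last by rewrite -divn_eq.
by rewrite divnMDl ?(leq_ltn_trans _ jn) // divn_small // modnMDl modn_small // addn0.
Qed.

Lemma exec_code n d c r s : 0 < n -> wf d c -> d <= K -> size r = d ->
  all (gtn n) r ->
  exec (code d c) (rep n r s) (cost c).[n]%R (rep n r (den n r c s)).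
Proof.
move=> n0; elim: c d r s => [|c1 IH1 c2 IH2|c IH|q x y c1 IH1 c2 IH2|q x y b|b] d r s /=.
all: move=> wfc dK sr rn.
all: have nthn z : nth 0 r z < n
  by case: (ltnP z (size r)) => zr; [apply: (allP rn); rewrite mem_nth|rewrite nth_default].
- rewrite [X in exec _ _ _ (_, X)](_ : _ =
    (fun t => if pred0 t then (heads r s t + delta Stay)%R else heads r s t)) //.
  by rewrite hornerC; apply: exec_slide.
- have /andP[w1 w2] := wfc; rewrite hornerD.
  exact: exec_seq (IH1 _ _ _ w1 dK sr rn) (IH2 _ _ _ w2 dK sr rn).
- have /andP[dK1 w1] := wfc.
  pose st i := foldl (fun s i => den n (rcons r i) c s) s (iota 0 i).
  pose S i : env Tp := rep n (rcons r i) (st i).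
  have Hh i s' t : heads (rcons r i) s' t = hset (heads r s') (vtape d) i t.
    rewrite /hset; case: t => [[q|x]|] //=.
    have -> : (Some (inr x) == vtape d) = (x == d :> nat).
      by rewrite -[LHS]/(x == inord d) -val_eqE /= inordK // ltnS ltnW.
    rewrite nth_rcons sr; case: ltngtP => // xd.
    by rewrite nth_default // sr ltnW.
  have Hv s' : heads r s' (vtape d) = 0%R.
    by rewrite heads_vtape ?(ltnW dK1) // nth_default // sr.
  have E1 : exec (While (fun rd => rd (vtape d) == Some true)
                  (Seq (code d.+1 c) (slide (pred1 (vtape d)) MoveR)))
                (S 0) (n * ((cost c).[n]%R + 1).+1).+1 (S n).
    apply: exec_while.
      move=> i ni; split.
        by rewrite -[scan _ _]/(contents n (st i) (vtape d) (heads (rcons r i) (st i) (vtape d))) Hh /hset eqxx /= ifT //; lia.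
      apply: (@exec_seq _ _ _ _ _ (rep n (rcons r i) (st i.+1))).
        rewrite /st -[i.+1]addn1 iotaD cats1 foldl_rcons add0n.
        apply: IH => //; first by rewrite size_rcons sr.
        by rewrite all_rcons rn andbT.
      rewrite [S i.+1](_ : _ = (contents n (st i.+1), fun t => if pred1 (vtape d) t then
        (heads (rcons r i) (st i.+1) t + delta MoveR)%R else heads (rcons r i) (st i.+1) t)).
        exact: exec_slide.
      congr pair; apply: functional_extensionality => t; rewrite !Hh /hset /=.
      by case: eqP => // _; lia.
    by rewrite -[scan _ _]/(contents n (st n) (vtape d) (heads (rcons r n) (st n) (vtape d))) Hh /hset eqxx /= ifF //; lia.
  (* An unbound level has the value 0, so entering the loop moves no head. *)
  have E0 : S 0 = rep n r s.
    congr pair; apply: functional_extensionality => t; rewrite Hh /hset.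
    by case: eqP => // ->; rewrite Hv.
  have E2 : exec (home (pred1 (vtape d)) (vtape d)) (S n) (n.*2 + 3)
      (rep n r (foldl (fun s i => den n (rcons r i) c s) s (iota 0 n))).
    rewrite [X in exec _ _ _ X](_ : _ = (contents n (st n),
      fun t => if pred1 (vtape d) t then (heads (rcons r n) (st n) t - Posz n)%R
               else heads (rcons r n) (st n) t)).
      apply: exec_home => [|||//]; first exact: eqxx.
        by rewrite Hh /hset eqxx.
      by move=> i ni; rewrite /= ifT //; lia.
    congr pair; apply: functional_extensionality => t; rewrite Hh /hset /=.
    by case: eqP => // ->; rewrite Hv subrr.
  rewrite E0 in E1; apply: exec_leq (exec_seq E1 E2).
  rewrite !hornerD hornerMX !hornerD !hornerC; lia.
- have /and4P[xK yK w1 w2] := wfc.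
  apply: (@exec_leq _ _ _ (seek_cost.[n] + (mhome_cost.[n] + ((cost c1).[n] + (cost c2).[n])).+1)%R).
    by rewrite !hornerD !hornerC; lia.
  apply: exec_seq; first by apply: exec_seek; rewrite ?sr.
  apply: exec_if.
  set H := hset _ _ _.
  have -> : scan (contents n s, H) (mtape q) = Some (mat s q (nth 0 r x) (nth 0 r y)).
    rewrite -[LHS]/(contents n s (mtape q) (H (mtape q))) /H /hset eqxx.
    exact: contents_mtape.
  rewrite (inj_eq Some_inj) eqb_id /H.
  case: (mat s q _ _).
    apply: exec_leq (exec_seq (exec_mhome r s q _ _) (IH1 d r s w1 dK sr rn)) => //.
    by rewrite leq_add2l leq_addr.
  apply: exec_leq (exec_seq (exec_mhome r s q _ _) (IH2 d r s w2 dK sr rn)) => //.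
  by rewrite leq_add2l leq_addl.
- have /andP[xK yK] := wfc.
  apply: (@exec_leq _ _ _ (seek_cost.[n] + (1 + mhome_cost.[n]))%R).
    by rewrite !hornerD !hornerC.
  apply: exec_seq; first by apply: exec_seek; rewrite ?sr.
  set s' := set_mat _ _ _ _ _.
  apply: (@exec_seq _ _ _ _ _ (contents n s', hset (heads r s) (mtape q) (nth 0 r x * n + nth 0 r y)%N)); last first.
    exact: (exec_mhome r s').
  rewrite [contents n s'](_ : _ = fun t p => if (t == mtape q) &&
     (p == hset (heads r s) (mtape q) (nth 0 r x * n + nth 0 r y)%N (mtape q)) then Some b
     else contents n s t p); first exact: exec_put.
  apply: functional_extensionality => t; apply: functional_extensionality => p.
  rewrite /hset eqxx; case: t => [[q'|z]|] //=.
  rewrite -[Some _ == _]/(eqb q' q).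
  case: ifP => [p0|np]; last by rewrite ifF //; have := nthn x; have := nthn y; nia.
  rewrite eq_cell //; case/andP: p0 => // _ _.
  by rewrite -[q' == q]/(eqb q' q); case: ifP.
- rewrite hornerC; apply: (@exec_seq _ _ _ _ 1 (contents n (emit b s), heads r s) 1).
    rewrite [contents n _](_ : _ = fun t p => if (t == None) && (p == heads r s None)
       then Some b else contents n s t p); first exact: exec_put.
    apply: functional_extensionality => t; apply: functional_extensionality => p.
    case: t => [[]|] //=; rewrite map_rcons nth_rcons size_map.
    case: ifP => p0; last by rewrite ifF //; lia.
    case: ltngtP => pz; first by rewrite ifF //; lia.
      by rewrite ifF ?nth_default ?size_map //; lia.
    by rewrite ifT //; lia.
  rewrite [rep _ _ _](_ : _ = (contents n (emit b s), fun t => if pred1 None t then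
    (heads r s t + delta MoveR)%R else heads r s t)); first exact: exec_slide.
  congr pair; apply: functional_extensionality => t /=.
  by case: t => [[]|] //=; rewrite size_rcons; lia.
Qed.

(** Needed to pay for the final return of the output head, whose cost is linear in the length of the
    output. *)
Lemma size_out_den n r c s : size (out (den n r c s)) <= size (out s) + (cost c).[n]%R.
Proof.
elim: c r s => [|c1 IH1 c2 IH2|c IH|q x y c1 IH1 c2 IH2|q x y b|b] r s /=; try lia.
- by rewrite hornerD; have := IH1 r s; have := IH2 r (den n r c1 s); lia.
- rewrite !hornerD hornerMX hornerD !hornerC.
  suff H l : size (out (foldl (fun s i => den n (rcons r i) c s) s l)) <=
      size (out s) + (cost c).[n]%R * size l by have := H (iota 0 n); rewrite size_iota; lia.
  elim: l s => [|i l IHl] s /=; first lia.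
  by have := IHl (den n (rcons r i) c s); have := IH (rcons r i) s; nia.
- rewrite !hornerD !hornerC; case: ifP => _.
    by have := IH1 r s; lia.
  by have := IH2 r s; lia.
- by rewrite size_rcons hornerC; lia.
Qed.

(** The input is erased while it is copied: its unary part becomes the ones of all variable tapes,
    its bits fill matrix [true], and [andb q] fills matrix [false] with zeros. An erased tape cannot
    guide its own head back from [n * n + n + 1], so this head rides along with the matrix tapes by
    [n * n], then with the variable tapes by [n], and then moves once more. *)
Definition load : cmd Tp :=
  Seq (While (fun rd => rd None == Some true)
         (Act (fun rd t => match t with
            | None => (None, MoveR)
            | Some (inl _) => (rd t, Stay)
            | Some (inr _) => (Some true, MoveR)
            end)))
 (Seq (Act (fun rd t => if t is None then (None, MoveR) else (rd t, Stay)))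
 (Seq (While (fun rd => rd None != None)
         (Act (fun rd t => match t with
            | None => (None, MoveR)
            | Some (inl q) => (omap (andb q) (rd None), MoveR)
            | Some (inr _) => (rd t, Stay)
            end)))
 (Seq (home (fun t => if t is Some (inr _) then false else true) (mtape true))
 (Seq (home (fun t => if t is Some (inl _) then false else true) (vtape 0))
      (slide (pred1 None) MoveL))))).

Definition loaded (n : nat) (b : seq bool) : store :=
  Store (fun q i j => q && nth false b (i * n + j)) [::].

Lemma exec_load n b : size b = n * n ->
  exec load (input_env (bool + 'I_K.+1)%type (nseq n true ++ false :: b))
    (4 * n * n + 4 * n + 10) (rep n [::] (loaded n b)).
Proof.
move=> sb; set w := nseq n true ++ false :: b.
have wE (i : nat) : nth None (map Some w) i =
    if i < n then Some true else if i == n then Some false else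
    nth None (map Some b) (i - n.+1).
  rewrite map_cat nth_cat size_map size_nseq; case: ltnP => ni.
    by rewrite (nth_map false) ?size_nseq // nth_nseq ni.
  case: eqP => [->|ne]; first by rewrite subnn.
  by rewrite (_ : i - n = (i - n.+1).+1) //; lia.
pose S1 (i : nat) : env Tp :=
  (fun t (p : int) => match t with
     | None => if (i%:Z <= p)%R then nth None (map Some w) `|p| else None
     | Some (inl _) => None
     | Some (inr _) => if ((0 <= p) && (p < i%:Z))%R then Some true else None
     end,
   fun t => match t with Some (inl _) => 0%R | _ => i%:Z%R end).
pose S2 (i : nat) : env Tp :=
  (fun t (p : int) => match t with
     | None => if ((n + 1 + i)%N%:Z <= p)%R then nth None (map Some w) `|p| else None
     | Some (inl q) => if ((0 <= p) && (p < i%:Z))%R then Some (q && nth false b `|p|) else None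
     | Some (inr _) => if ((0 <= p) && (p < n%:Z))%R then Some true else None
     end,
   fun t => match t with None => (n + 1 + i)%N%:Z%R | Some (inl _) => i%:Z%R
            | Some (inr _) => n%:Z%R end).
have E1 : exec (While (fun rd => rd None == Some true)
         (Act (fun rd t => match t with
            | None => (None, MoveR)
            | Some (inl _) => (rd t, Stay)
            | Some (inr _) => (Some true, MoveR)
            end))) (S1 0) (n * 2).+1 (S1 n).
  apply: exec_while.
    move=> i ni; split; first by rewrite /scan /= lexx ?absz_nat wE ni.
    rewrite [S1 i.+1](_ : _ = perform (fun t => match t with
            | None => (None, MoveR)
            | Some (inl _) => (scan (S1 i) t, Stay)
            | Some (inr _) => (Some true, MoveR)
            end) (S1 i)); first exact: exec_act.
    congr pair; apply: functional_extensionality => t; last by case: t => [[q|x]|] /=; lia.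
    apply: functional_extensionality => p; case: t => [[q|x]|] /=.
    - by rewrite /scan /=; case: ifP.
    - case: eqP => [->|pi]; first by rewrite ifT //; lia.
      by congr (if _ then _ else _); lia.
    - case: eqP => [->|pi]; first by rewrite ifF //; lia.
      by congr (if _ then _ else _); lia.
  by rewrite /scan /= lexx ?absz_nat wE ltnn eqxx.
have E2 : exec (Act (fun rd (t : Tp) => if t is None then (None, MoveR) else (rd t, Stay)))
    (S1 n) 1 (S2 0).
  rewrite [S2 0](_ : _ = perform (fun t : Tp => if t is None then (None, MoveR) else (scan (S1 n) t, Stay)) (S1 n)).
    exact: exec_act.
  congr pair; apply: functional_extensionality => t; last by case: t => [[q|x]|] /=; lia.
  apply: functional_extensionality => p; case: t => [[q|x]|] /=.
  - by rewrite /scan /=; case: ifP; case: ifP => //; lia.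
  - by rewrite /scan /=; case: eqP => // ->.
  - case: eqP => [->|pi]; first by rewrite ifF //; lia.
    by congr (if _ then _ else _); lia.
have rd2 (i : nat) : scan (S2 i) None = nth None (map Some b) i.
  rewrite /scan /= lexx ?absz_nat wE ifF; last lia.
  by rewrite ifF; last lia; congr nth; lia.
have E3 : exec (While (fun rd => rd None != None)
         (Act (fun rd (t : Tp) => match t with
            | None => (None, MoveR)
            | Some (inl q) => (omap (andb q) (rd None), MoveR)
            | Some (inr _) => (rd t, Stay)
            end))) (S2 0) (n * n * 2).+1 (S2 (n * n)).
  apply: exec_while; last by rewrite rd2 nth_default // size_map sb.
  move=> i ni.
  have Ei : scan (S2 i) None = Some (nth false b i).
    by rewrite rd2 (nth_map false) // sb.
  split; first by rewrite Ei.
  rewrite [S2 i.+1](_ : _ = perform (fun t : Tp => match t with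
            | None => (None, MoveR)
            | Some (inl q) => (omap (andb q) (scan (S2 i) None), MoveR)
            | Some (inr _) => (scan (S2 i) t, Stay)
            end) (S2 i)); first exact: exec_act.
  rewrite Ei; congr pair; apply: functional_extensionality => t; last by case: t => [[q|x]|] /=; lia.
  apply: functional_extensionality => p; case: t => [[q|x]|] /=.
  - case: eqP => [->|pi]; first by rewrite ifT //; lia.
    by congr (if _ then _ else _); lia.
  - by rewrite /scan /=; case: eqP => // ->.
  - case: eqP => [->|pi]; first by rewrite ifF //; lia.
    by congr (if _ then _ else _); lia.
pose H3 (t : Tp) : int := match t with None => (n + 1)%N | Some (inl _) => 0%R | Some (inr _) => n end.
have E4 : exec (home (fun t : Tp => if t is Some (inr _) then false else true) (mtape true))
    (S2 (n * n)) ((n * n).*2 + 3) ((S2 (n * n)).1, H3).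
  rewrite [H3](_ : _ = fun t => if (if t is Some (inr _) then false else true) then
    ((S2 (n * n)).2 t - (n * n)%N%:Z)%R else (S2 (n * n)).2 t).
    apply: (exec_home (P := fun t : Tp => if t is Some (inr _) then false else true)) => //.
    by move=> i ni; rewrite /= ifT //; lia.
  by apply: functional_extensionality => -[[q|x]|] /=; lia.
pose H4 (t : Tp) : int := if t is None then 1%R else 0%R.
have E5 : exec (home (fun t : Tp => if t is Some (inl _) then false else true) (vtape 0))
    ((S2 (n * n)).1, H3) (n.*2 + 3) ((S2 (n * n)).1, H4).
  rewrite [H4](_ : _ = fun t => if (if t is Some (inl _) then false else true) then
    (H3 t - n%:Z)%R else H3 t).
    apply: (exec_home (P := fun t : Tp => if t is Some (inl _) then false else true)) => //.
    by move=> i ni; rewrite /= ifT //; lia.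
  by apply: functional_extensionality => -[[q|x]|] /=; lia.
have E6 : exec (slide (pred1 None) MoveL) ((S2 (n * n)).1, H4) 1 (rep n [::] (loaded n b)).
  rewrite [rep _ _ _](_ : _ = ((S2 (n * n)).1, fun t => if pred1 None t then (H4 t + delta MoveL)%R else H4 t)).
    exact: exec_slide.
  congr pair; apply: functional_extensionality => t; last by case: t => [[q|x]|] //=; rewrite nth_nil.
  apply: functional_extensionality => p; case: t => [[q|x]|] //=.
    by rewrite -divn_eq.
  rewrite nth_nil if_same; case: ifP => // p0; rewrite nth_default // size_map.
  by rewrite /w size_cat size_nseq /= sb; lia.
have S10 : S1 0 = input_env (bool + 'I_K.+1)%type w.
  congr pair; last by apply: functional_extensionality => -[[q|x]|].
  apply: functional_extensionality => t; apply: functional_extensionality => p.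
  by case: t => [[q|x]|] //=; case: ifP => //; lia.
rewrite -S10; apply: exec_leq (exec_seq E1 (exec_seq E2 (exec_seq E3 (exec_seq E4 (exec_seq E5 E6))))).
lia.
Qed.

Definition prog_machine (c : prog) : machine :=
  compiled (Seq load (Seq (code 0 c) (home (pred1 None) None))).

Lemma prog_machineP (c : prog) : wf 0 c ->
  exists p : {poly nat}, forall n b, 0 < n -> size b = n * n ->
    let w := nseq n true ++ false :: b in
    computes_within (prog_machine c) p.[size w]%R w (out (den n [::] c (loaded n b))).
Proof.
move=> wc.
(* Loading costs [4 n^2 + 4 n + 10], the program its [cost], and the way home twice the output
   length plus 3, hence at most two more [cost] plus 3. *)
exists (4%N%:P * 'X * 'X + 4%N%:P * 'X + 13%N%:P + cost c + cost c + cost c)%R.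
move=> n b n0 sb w; set s := den _ _ _ _.
have E1 := exec_load sb.
have E2 := exec_code (r := [::]) (loaded n b) n0 wc isT erefl isT.
have E3 : exec (home (pred1 None) None) (rep n [::] s) ((size (out s)).*2 + 3)
    (contents n s, heads [::] (Store (mat s) [::])).
  rewrite [heads [::] (Store _ _)](_ : _ = fun t => if pred1 None t then
     (heads [::] s t - (size (out s))%:Z)%R else heads [::] s t).
    apply: exec_home => // i ni.
    by rewrite /= (nth_map false).
  by apply: functional_extensionality => -[[q|x]|] //=; lia.
have so := size_out_den n [::] c (loaded n b).
apply: compiled_correct.
  apply: exec_leq (exec_seq E1 (exec_seq E2 E3)).
  have wn : n <= size w by rewrite size_cat size_nseq leq_addr.
  (* The bounds are in [n], but the claim is in the input length, which is at least [n]. *)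
  have mono (p : {poly nat}) : (p.[n] <= p.[size w])%N%R.
    rewrite !horner_coef; apply: leq_sum => i _.
    apply: leq_mul => //; elim: (i : nat) => // k IHk.
    by rewrite !exprS; apply: leq_mul.
  apply: (@leq_trans ((4%N%:P * 'X * 'X + 4%N%:P * 'X + 13%N%:P + cost c + cost c + cost c).[n])%R); last exact: mono.
  rewrite !hornerD !hornerMX !hornerC.
  have {}so : size (out s) <= (cost c).[n]%R by exact: so.
  rewrite -[X in _ <= X]/(4 * n * n + 4 * n + 13 + (cost c).[n]%R +
    (cost c).[n]%R + (cost c).[n]%R).
  lia.
by [].
Qed.

End Prog.

(** * Sums of squares of biquadratic forms *)

Lemma seq_max d (T : orderType d) (s : seq T) : s != [::] ->
  exists2 x, x \in s & forall y, y \in s -> (y <= x)%O.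
Proof.
elim: s => // x0 s IH _; case: (eqVneq s [::]) => [->|/IH [x xs xge]].
  by exists x0 => [|y]; rewrite inE // => /eqP ->.
case: (leP x0 x) => h.
  by exists x => [|y]; rewrite inE ?xs ?orbT // => /orP[/eqP ->|/xge].
exists x0 => [|y]; rewrite inE ?eqxx // => /orP[/eqP -> //|/xge h'].
exact: le_trans h' (ltW h).
Qed.

Section SumsOfSquares.
Local Open Scope ring_scope.
Variables (R : realType) (n : nat).
Implicit Types (p q : {mpoly R[n]}) (m : 'X_{1..n}) (M : 'M[R]_n).

Definition biquad M : {mpoly R[n]} :=
  \sum_(i < n) \sum_(j < n) M i j *: ('X_i ^+ 2 * 'X_j ^+ 2).

Definition sqm (i j : 'I_n) : 'X_{1..n} := (U_(i) *+ 2 + U_(j) *+ 2)%MM.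

Lemma sqmE i j l : sqm i j l = ((i == l) * 2 + (j == l) * 2)%N.
Proof. by rewrite /sqm mnmDE !mulmnE !mnm1E. Qed.

Lemma sqm_eq (i j k l : 'I_n) : (sqm k l == sqm i j) =
  (k == i) && (l == j) || (k == j) && (l == i).
Proof.
apply/eqP/idP; last first.
  by case/orP=> /andP[/eqP-> /eqP->] //; rewrite /sqm addmC.
move=> E; have := congr1 (fun m : 'X_{1..n} => m i) E.
have := congr1 (fun m : 'X_{1..n} => m j) E.
have := congr1 (fun m : 'X_{1..n} => m k) E.
have := congr1 (fun m : 'X_{1..n} => m l) E.
rewrite !sqmE !eqxx (eq_sym j i) (eq_sym i k) (eq_sym j k) (eq_sym i l) (eq_sym j l) (eq_sym l k).
by case: (i == j); case: (k == i); case: (k == j); case: (l == i); case: (l == j); case: (k == l).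
Qed.

Lemma coef_biquad M m : (biquad M)@_m =
  \sum_(i < n) \sum_(j < n) M i j * (sqm i j == m)%:R.
Proof.
rewrite raddf_sum; apply: eq_bigr => i _; rewrite raddf_sum; apply: eq_bigr => j _.
by rewrite /= mcoeffZ !mpolyXn -mpolyXD mcoeffX.
Qed.

Lemma coef_biquad_sqm M i j : M^T = M ->
  (biquad M)@_(sqm i j) = if i == j then M i j else M i j *+ 2.
Proof.
move=> sM; rewrite coef_biquad (bigD1 i) //= (bigD1 j) //= sqm_eq !eqxx /= mulr1.
have S (k : 'I_n) (P : pred 'I_n) : (forall l, P l -> ~~ (sqm k l == sqm i j)) ->
    \sum_(l | P l) M k l * (sqm k l == sqm i j)%:R = 0.
  by move=> H; apply: big1 => l /H /negPf ->; rewrite mulr0.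
rewrite S ?addr0; last by move=> l lj; rewrite sqm_eq eqxx (negPf lj) /=; apply: contraNN lj => /andP[/eqP<- /eqP->].
case: (eqVneq i j) => [ij|ij].
  rewrite big1 ?addr0 // => k ki; rewrite S // => l _.
  by rewrite sqm_eq -ij (negPf ki).
rewrite (bigD1 j) 1?eq_sym //= (bigD1 i) //= sqm_eq !eqxx orbT mulr1.
rewrite S ?addr0; last first.
  by move=> l li; rewrite sqm_eq eqxx (negPf li) eq_sym (negPf ij).
rewrite big1 ?addr0; last first.
  move=> k /andP[ki kj]; rewrite S // => l _.
  by rewrite sqm_eq (negPf ki) (negPf kj).
by rewrite (_ : M j i = M i j) ?mulr2n // -{1}sM mxE.
Qed.

Lemma biquad_deg M m : (biquad M)@_m != 0 -> mdeg m = 4.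
Proof.
move=> nz; apply/eqP; apply: contraNT nz => m4; rewrite coef_biquad.
rewrite big1 // => i _; rewrite big1 // => j _.
case: eqP => [E|]; last by rewrite mulr0.
by move: m4; rewrite -E /sqm mdegD !mdegMn !mdeg1.
Qed.

(** Let [mp] be the largest monomial occurring in any summand. The coefficient of [mp + mp] in the
    sum is a sum of squares, not all zero, so nothing cancels and [mp + mp] has degree 4. The
    monomial order refines the degree, which bounds all other monomials. *)
Lemma sos_deg M (s : seq {mpoly R[n]}) : biquad M = \sum_(q <- s) q ^+ 2 ->
  forall q, q \in s -> forall m, m \in msupp q -> (mdeg m <= 2)%N.
Proof.
move=> E q qs m mq.
pose L := flatten [seq msupp q | q <- s].
have inL q' m' : q' \in s -> m' \in msupp q' -> m' \in L.
  by move=> q's m'q; apply/flattenP; exists (msupp q') => //; apply: map_f.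
have [mp mpL leL] : exists2 mp, mp \in L & forall m', m' \in L -> (m' <= mp)%O.
  by apply: seq_max; apply/eqP => L0; have := inL _ _ qs mq; rewrite L0.
have lead_le q' : q' \in s -> (mlead q' <= mp)%O.
  move=> q's; case: (eqVneq q' 0) => [->|nz]; first by rewrite mlead0 le0x.
  by apply: leL; apply: inL q's _; apply: mlead_supp.
have coefE : (biquad M)@_(mp + mp)%MM = \sum_(q' <- s) q'@_mp ^+ 2.
  rewrite E raddf_sum; apply: eq_big_seq => q' q's.
  by rewrite /= expr2 mleadcMW ?lead_le.
have : (biquad M)@_(mp + mp)%MM != 0.
  have /flattenP[_ /mapP[q' q's ->] mpq] := mpL.
  rewrite coefE psumr_eq0; last by move=> *; apply: sqr_ge0.
  by apply/allPn; exists q' => //=; rewrite sqrf_eq0 -mcoeff_msupp.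
move/biquad_deg; rewrite mdegD => d4.
by apply: leq_trans (lemc_mdeg (leL _ (inL _ _ qs mq))) _; lia.
Qed.

(** [L] only has to contain the exponents that can contribute, which reduces the convolution to a
    sum over an explicit short list. *)
Lemma coef_sqr q m (L : seq 'X_{1..n}) : uniq L ->
  (forall k, k \in msupp q -> (m - k)%MM \in msupp q -> (k <= m)%MM -> k \in L) ->
  (forall k, k \in L -> (k <= m)%MM) ->
  (q ^+ 2)@_m = \sum_(k <- L) q@_k * q@_(m - k).
Proof.
move=> uL sL leL.
pose F k := if (k <= m)%MM then q@_k * q@_(m - k) else 0.
have -> : (q ^+ 2)@_m = \sum_(k <- msupp q) F k.
  rewrite expr2 {1}[q]mpolyE mulr_suml raddf_sum; apply: eq_bigr => k _ /=.
  rewrite -scalerAl mcoeffZ /F; case: ifP => km.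
    rewrite -commr_mpolyX; congr (_ * _).
    by rewrite -{1}(submK km) addmC mcoeffMX.
  suff -> : ('X_[k] * q)@_m = 0 by rewrite mulr0.
  apply: memN_msupp_eq0; apply: contraFN km => /msuppM_le /allpairsP[[k1 k2] /= [k1k _ ->]].
  move: k1k; rewrite msuppX inE => /eqP ->.
  by apply/mnm_lepP => i; rewrite mnmDE leq_addr.
rewrite (bigID (mem L)) /= [X in _ + X]big_seq_cond [X in _ + X]big1 ?addr0; last first.
  move=> k /andP[kq kL]; rewrite /F; case: ifP => // km.
  apply/eqP; rewrite mulf_eq0; apply/orP; right.
  by rewrite mcoeff_eq0; apply: contra kL => h; apply: sL.
rewrite [RHS](bigID (mem (msupp q))) /= [X in _ = _ + X]big1 ?addr0; last first.
  by move=> k; rewrite -mcoeff_eq0 => /eqP ->; rewrite mul0r.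
rewrite -[LHS]big_filter -[RHS]big_filter.
rewrite (perm_big [seq k <- L | k \in msupp q]); last first.
  apply: uniq_perm; rewrite ?filter_uniq // => k.
  by rewrite !mem_filter andbC.
by apply: eq_big_seq => k; rewrite mem_filter /F => /andP[_ /leL ->].
Qed.

Lemma deg2_below (i j : 'I_n) k : mdeg k = 2 -> (k <= sqm i j)%MM ->
  [\/ k = (U_(i) *+ 2)%MM, k = (U_(j) *+ 2)%MM | k = (U_(i) + U_(j))%MM].
Proof.
move=> d2 /mnm_lepP le.
have k0 l : l != i -> l != j -> k l = 0%N.
  move=> li lj; have := le l; rewrite sqmE !(eq_sym _ l) (negPf li) (negPf lj).
  by rewrite leqn0 => /eqP.
case: (eqVneq i j) => [ij|ij].
  constructor 1; apply/mnmP => l; rewrite mulmnE mnm1E eq_sym.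
  case: (eqVneq l i) => [->|li]; last by rewrite k0 // -ij.
  by move: d2; rewrite mdegE (bigD1 i) //= big1 ?addn0 // => l' l'i; rewrite k0 // -ij.
have s2 : (k i + k j = 2)%N.
  move: d2; rewrite mdegE (bigD1 i) //= (bigD1 j) 1?eq_sym //= big1 ?addn0 //.
  by move=> l /andP[]; apply: k0.
have ext (m : 'X_{1..n}) : m i = k i -> m j = k j ->
    (forall l, l != i -> l != j -> m l = 0%N) -> k = m.
  move=> mi mj ml; apply/mnmP => l.
  case: (eqVneq l i) => [->|li] //; case: (eqVneq l j) => [->|lj] //.
  by rewrite k0 // ml.
case E: (k i) s2 => [|[|[|e]]] s2 //.
- constructor 2; apply: ext => [||l li lj]; rewrite mulmnE mnm1E; move: s2; rewrite ?E ?eqxx 1?eq_sym ?(negPf ij) ?(negPf lj) //; lia.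
- constructor 3; apply: ext => [||l li lj]; rewrite mnmDE !mnm1E ?eqxx ?E.
  + by rewrite eq_sym (negPf ij).
  + by rewrite (negPf ij); lia.
  + by rewrite !(eq_sym _ l) (negPf li) (negPf lj).
- constructor 1; apply: ext => [||l li lj]; rewrite mulmnE mnm1E ?eqxx ?E.
  + by [].
  + by rewrite (negPf ij); lia.
  + by rewrite (eq_sym _ l) (negPf li).
Qed.

(** The degree bound forces both factors of the quartic monomial to be quadratic. The extra square,
    from the coefficient of [x_i x_j], is the source of the inequality between [M] and the Gram
    matrix. *)
Lemma coef_sqr_sqm q i j : (forall m, m \in msupp q -> (mdeg m <= 2)%N) ->
  (q ^+ 2)@_(sqm i j) = if i == j then q@_(U_(i) *+ 2) ^+ 2 else
   q@_(U_(i) *+ 2) * q@_(U_(j) *+ 2) *+ 2 + q@_(U_(i) + U_(j)) ^+ 2.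
Proof.
move=> dq.
have deg2 k : k \in msupp q -> (sqm i j - k)%MM \in msupp q -> (k <= sqm i j)%MM -> mdeg k = 2.
  move=> /dq d1 /dq d2 /submK /(congr1 mdeg).
  by rewrite mdegD [in RHS]/sqm mdegD !mdegMn !mdeg1; lia.
have sub1 : (sqm i j - U_(i) *+ 2 = U_(j) *+ 2)%MM by rewrite /sqm addmC addmK.
have sub2 : (sqm i j - U_(j) *+ 2 = U_(i) *+ 2)%MM by rewrite /sqm addmK.
have le1 : (U_(i) *+ 2 <= sqm i j)%MM by apply/mnm_lepP => l; rewrite sqmE mulmnE mnm1E leq_addr.
have le2 : (U_(j) *+ 2 <= sqm i j)%MM by apply/mnm_lepP => l; rewrite sqmE mulmnE mnm1E leq_addl.
case: (eqVneq i j) => [ij|ij].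
  rewrite (@coef_sqr _ _ [:: U_(i) *+ 2]%MM) //.
  - by rewrite big_seq1 sub1 -ij expr2.
  - move=> k k1 k2 le; have [] := deg2_below (deg2 _ k1 k2 le) le; rewrite -?ij inE => -> //.
  - by move=> k; rewrite inE => /eqP ->.
have sub3 : (sqm i j - (U_(i) + U_(j)) = U_(i) + U_(j))%MM.
  by apply/mnmP => l; rewrite mnmBE sqmE mnmDE !mnm1E; lia.
have ne1 : (U_(i) *+ 2 == U_(j) *+ 2 :> 'X_{1..n})%MM = false.
  by apply/eqP => /mnmP /(_ i); rewrite !mulmnE !mnm1E eqxx eq_sym (negPf ij).
have ne2 : (U_(i) *+ 2 == U_(i) + U_(j) :> 'X_{1..n})%MM = false.
  by apply/eqP => /mnmP /(_ i); rewrite mnmDE !mulmnE !mnm1E eqxx eq_sym (negPf ij).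
have ne3 : (U_(j) *+ 2 == U_(i) + U_(j) :> 'X_{1..n})%MM = false.
  by apply/eqP => /mnmP /(_ i); rewrite mnmDE !mulmnE !mnm1E eqxx eq_sym (negPf ij).
rewrite (@coef_sqr _ _ [:: U_(i) *+ 2; U_(j) *+ 2; U_(i) + U_(j)]%MM) /=.
- rewrite !big_cons big_nil sub1 sub2 sub3; ring.
- by rewrite !inE ne1 ne2 ne3.
- move=> k k1 k2 le; have [] := deg2_below (deg2 _ k1 k2 le) le => ->; rewrite !inE eqxx ?orbT //.
- move=> k; rewrite !inE => /or3P[] /eqP -> //.
  by apply/mnm_lepP => l; rewrite sqmE mnmDE !mnm1E; lia.
Qed.

Lemma is_sosD p q : is_sos p -> is_sos q -> is_sos (p + q).
Proof. by move=> [s ->] [t ->]; exists (s ++ t); rewrite big_cat. Qed.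

Lemma is_sos_sum (I : Type) (r : seq I) (F : I -> {mpoly R[n]}) :
  (forall i, is_sos (F i)) -> is_sos (\sum_(i <- r) F i).
Proof.
move=> HF; elim: r => [|i r IH]; first by exists [::]; rewrite !big_nil.
by rewrite big_cons; apply: is_sosD.
Qed.

Lemma is_sos_sqr q : is_sos (q ^+ 2).
Proof. by exists [:: q]; rewrite big_seq1. Qed.

(* A biquadratic form is a sum of squares iff its matrix dominates entrywise a
   Gram matrix; the vectors of the Gram matrix are the coefficients of the
   [x_i ^ 2] in the squared polynomials. *)
Lemma coneK0P M : coneK0 M <-> M^T = M /\
  exists s : seq ('I_n -> R), forall i j, \sum_(v <- s) v i * v j <= M i j.
Proof.
split=> -[sM].
  move=> [s E]; split=> //.
  exists [seq (fun i => q@_(U_(i) *+ 2)) | q : {mpoly R[n]} <- s] => i j.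
  rewrite big_map.
  have dq := sos_deg E.
  have := coef_biquad_sqm i j sM; rewrite /biquad E raddf_sum /=.
  rewrite (eq_big_seq _ (fun q qs => coef_sqr_sqm i j (dq q qs))).
  case: (eqVneq i j) => [<- <-|ij].
    by apply: lexx.
  rewrite big_split /= sumrMnl => E2.
  rewrite -(@ler_pMn2r _ 2) // -E2 lerDl.
  by apply: sumr_ge0 => q _; apply: sqr_ge0.
move=> [s Hs]; split=> //.
(* The slack is nonnegative, so each of its terms is the square of [Num.sqrt (N i j) x_i x_j]. *)
pose N i j := M i j - \sum_(v <- s) v i * v j.
rewrite (_ : (\sum_(i < n) \sum_(j < n) M i j *: ('X_i ^+ 2 * 'X_j ^+ 2)) =
  \sum_(v <- s) (\sum_(i < n) v i *: 'X_i ^+ 2) ^+ 2 +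
  \sum_(i < n) \sum_(j < n) (Num.sqrt (N i j) *: ('X_i * 'X_j : {mpoly R[n]})) ^+ 2).
  apply: is_sosD; first by apply: is_sos_sum => v; apply: is_sos_sqr.
  by do 2![apply: is_sos_sum => ?]; apply: is_sos_sqr.
have -> : \sum_(v <- s) (\sum_(i < n) v i *: 'X_i ^+ 2) ^+ 2 =
   \sum_(i < n) \sum_(j < n) (\sum_(v <- s) v i * v j) *: ('X_i ^+ 2 * 'X_j ^+ 2) :> {mpoly R[n]}.
  rewrite (eq_bigr (fun v => \sum_(i < n) \sum_(j < n) (v i * v j) *: ('X_i ^+ 2 * 'X_j ^+ 2))).
    rewrite exchange_big; apply: eq_bigr => i _.
    by rewrite exchange_big; apply: eq_bigr => j _; rewrite scaler_suml.
  move=> v _; rewrite expr2 mulr_suml; apply: eq_bigr => i _.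
  rewrite mulr_sumr; apply: eq_bigr => j _.
  by rewrite -scalerAl -scalerAr scalerA.
rewrite -big_split; apply: eq_bigr => i _; rewrite -big_split; apply: eq_bigr => j _ /=.
rewrite exprZn sqr_sqrtr ?subr_ge0 // exprMn -scalerDl; congr (_ *: _).
by rewrite /N addrC subrK.
Qed.

End SumsOfSquares.

(** * Deleting edges and identifying twins *)

Lemma pairwise_uniq_in (T : eqType) (r : rel T) (s : seq T) : uniq s ->
  (forall x y, x \in s -> y \in s -> x != y -> r x y) -> pairwise r s.
Proof.
elim: s => //= x s IH /andP[xs us] H; rewrite IH // ?andbT.
  by apply/allP => y ys; apply: H; rewrite ?inE ?eqxx ?ys ?orbT //; apply: contraNneq xs => ->.
by move=> y z ys zs; apply: H; rewrite inE ?ys ?zs orbT.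
Qed.

(** * Stable sets as lists *)

Section Stable.
Variable G : graph.
Implicit Types S : {set 'I_(Defs.order G)}.

Lemma stableP S : reflect (forall i j, i \in S -> j \in S -> ~~ adj i j) (stable S).
Proof.
apply: (iffP forall_inP) => [H i j iS jS|H i iS].
  by have /forall_inP := H i iS; apply.
by apply/forall_inP => j jS; apply: H.
Qed.

Lemma stable_leq_alpha S : stable S -> #|S| <= alpha G.
Proof. by move=> SS; rewrite /alpha (bigD1 S) //= leq_maxl. Qed.

Lemma alpha_witness : exists2 S : {set 'I_(Defs.order G)}, stable S & #|S| = alpha G.
Proof.
have H : 0 < #|@stable G|.
  apply/card_gt0P; exists set0; rewrite unfold_in; apply/stableP => i j.
  by rewrite inE.
by have [S SS E] := @eq_bigmax_cond _ (@stable G) (fun S => #|S|) H; exists S.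
Qed.

(** With [i != j] included, a list that is pairwise [nonadj] has no repetition, so lists can stand
    for stable sets. *)
Definition nonadj : rel 'I_(Defs.order G) := fun i j => (i != j) && ~~ adj i j.

Lemma nonadj_seq_leq_alpha (s : seq 'I_(Defs.order G)) : pairwise nonadj s -> size s <= alpha G.
Proof.
rewrite pairwise_relI -uniq_pairwise => /andP[us ps].
rewrite -(card_uniqP us) -cardsE; apply: stable_leq_alpha; apply/stableP => i j.
rewrite !inE => si sj.
have sym : ssrbool.symmetric (fun x y : 'I_(Defs.order G) => ~~ adj x y).
  by move=> x y; rewrite adj_sym.
have [->|ij] := eqVneq i j; first by rewrite adj_irr.
elim: s {us} ps si sj => //= x s IH /andP[/allP xs ps].
rewrite !inE => /orP[/eqP ->|si] /orP[/eqP ->|sj].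
- by rewrite adj_irr.
- exact: xs.
- by rewrite adj_sym; apply: xs.
- exact: IH.
Qed.

Lemma stable_nonadj S : stable S -> pairwise nonadj (enum S).
Proof.
move=> /stableP SS; apply: pairwise_uniq_in (enum_uniq _) _ => x y.
by rewrite !mem_enum /nonadj => xS yS ->; apply: SS.
Qed.

End Stable.

(** * Gram matrices below a Boolean matrix *)

Section Gram.
Local Open Scope ring_scope.
Variables (R : realType) (a n : nat).
Implicit Types (A : nat -> nat -> bool) (s : seq (nat -> R)).

(** [A] plays the part of [A_G + I], indexed by [nat] as the matrices of loop programs are; its
    diagonal is data, so that it may be cleared too. *)
Definition dominates A s : Prop := forall i j, (i < n)%N -> (j < n)%N ->
  \sum_(v <- s) v i * v j <= a%:R * (A i j)%:R - 1.

Definition gram A : Prop := exists s, dominates A s.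

(** A diagonal Gram entry is a sum of squares and cannot be at most -1. This justifies the negative
    report. *)
Lemma gram_diag A i : gram A -> (i < n)%N -> A i i.
Proof.
move=> [s Hs] ni; have := Hs i i ni ni; case: (A i i) => //.
rewrite mulr0 => le1; exfalso.
have : 0 <= \sum_(v <- s) v i * v i by apply: sumr_ge0 => v _; rewrite -expr2 sqr_ge0.
by lra.
Qed.

(** With [m] elements the bound is [m (b - 1) - m (m - 1)]; it vanishes for [m = b], which is where
    the size [a] of the independent set enters. *)
Lemma sum_double_le (P : nat -> nat -> R) (b : R) (L : seq nat) :
  (forall x, x \in L -> P x x <= b - 1) ->
  pairwise (fun x y => (P x y <= -1) && (P y x <= -1)) L ->
  \sum_(x <- L) \sum_(y <- L) P x y <= (size L)%:R * (b - (size L)%:R).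
Proof.
elim: L => [|x L IH] Hd /=; first by rewrite big_nil mul0r.
move=> /andP[/allP Hx Hp].
rewrite !big_cons [X in _ + X](eq_bigr (fun y => P y x + \sum_(z <- L) P y z)); last first.
  by move=> y _; rewrite big_cons.
rewrite big_split /=.
have H1 := Hd x (mem_head _ _).
have {}IH : \sum_(x <- L) \sum_(y <- L) P x y <= (size L)%:R * (b - (size L)%:R).
  by apply: IH => // y yL; apply: Hd; rewrite inE yL orbT.
have cst (F : nat -> R) : (forall y, y \in L -> F y <= -1) -> \sum_(y <- L) F y <= - (size L)%:R.
  move=> HF; rewrite big_seq.
  apply: (@le_trans _ _ (\sum_(y <- L | y \in L) -1)); first exact: ler_sum.
  by rewrite -big_seq big_tnth sumr_const card_ord mulNrn.
have H2 := cst _ (fun y yL => proj1 (andP (Hx y yL))).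
have H3 := cst _ (fun y yL => proj2 (andP (Hx y yL))).
rewrite -natr1; nra.
Qed.

Definition indep A (L : seq nat) : bool := pairwise (fun x y => ~~ A x y) L.

Lemma sum_sqr_le0 (T : Type) (s : seq T) (F H : T -> R) :
  \sum_(v <- s) F v ^+ 2 <= 0 -> \sum_(v <- s) F v * H v = 0.
Proof.
elim: s => [|v s IH]; rewrite ?big_nil // !big_cons => le0.
have S0 : 0 <= \sum_(w <- s) F w ^+ 2 by apply: sumr_ge0 => w _; apply: sqr_ge0.
have v0 := sqr_ge0 (F v).
have /eqP : F v ^+ 2 = 0 by lra.
by rewrite sqrf_eq0 => /eqP ->; rewrite mul0r add0r IH //; lra.
Qed.

(* The indicator of an independent set of size [a] annihilates the quadratic
   form, hence is orthogonal to all the Gram vectors. *)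
Lemma dominates_indep A s (L : seq nat) H : dominates A s ->
  (forall i j, (i < n)%N -> (j < n)%N -> A i j = A j i) -> all (gtn n) L -> indep A L -> size L = a ->
  \sum_(v <- s) (\sum_(x <- L) v x) * H v = 0.
Proof.
move=> Hs sA Ln iL La; apply: sum_sqr_le0.
pose P x y := \sum_(v <- s) v x * v y.
have -> : \sum_(v <- s) (\sum_(x <- L) v x) ^+ 2 = \sum_(x <- L) \sum_(y <- L) P x y.
  rewrite /P.
  transitivity (\sum_(v <- s) \sum_(x <- L) \sum_(y <- L) v x * v y).
    by apply: eq_bigr => v _; rewrite expr2 mulr_suml; apply: eq_bigr => x _; rewrite mulr_sumr.
  rewrite exchange_big; apply: eq_bigr => x _; by rewrite exchange_big.
apply: le_trans (@sum_double_le P a%:R L _ _) _.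
- move=> x xL; have nx := allP Ln x xL; apply: le_trans (Hs x x nx nx) _.
  by rewrite lerD2r ler_piMr // lern1 leq_b1.
- move: iL Ln; rewrite /indep; elim: (L) => //= x l IH /andP[/allP xl il] /andP[nx nl].
  rewrite IH // andbT; apply/allP => y yl.
  have nAxy := negPf (xl y yl); have ny := allP nl y yl.
  by have := Hs x y nx ny; have := Hs y x ny nx; rewrite /P (sA y x ny nx) nAxy mulr0 sub0r => -> ->.
- by rewrite La subrr mulr0.
Qed.

(** Subtracting the orthogonality relations of [i :: S] and [j :: S] cancels the part of [S], so the
    Gram entries [ik] and [jk] agree. The case [k = i] is allowed. *)
Lemma dominates_merge A s i j k S : dominates A s ->
  (forall i j, (i < n)%N -> (j < n)%N -> A i j = A j i) -> (0 < a)%N -> all (gtn n) [:: i, j, k & S] ->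
  indep A (i :: S) -> indep A (j :: S) -> size S = a.-1 -> ~~ A j k ->
  \sum_(v <- s) v i * v k <= -1.
Proof.
move=> Hs sA a0 /= /and4P[ni nj nk nS] Hi Hj zS jk.
have Ei : \sum_(v <- s) (\sum_(x <- i :: S) v x) * v k = 0.
  by apply: (dominates_indep (fun v => v k) Hs sA) => //=; rewrite ?ni // zS prednK.
have Ej : \sum_(v <- s) (\sum_(x <- j :: S) v x) * v k = 0.
  by apply: (dominates_indep (fun v => v k) Hs sA) => //=; rewrite ?nj // zS prednK.
have := Hs j k nj nk; rewrite (negPf jk) mulr0 sub0r.
have E x : \sum_(v <- s) (\sum_(y <- x :: S) v y) * v k =
    \sum_(v <- s) v x * v k + \sum_(v <- s) (\sum_(y <- S) v y) * v k.
  by rewrite -big_split; apply: eq_bigr => v _; rewrite big_cons mulrDl.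
by move: Ei Ej; rewrite !E; lra.
Qed.

End Gram.

(** Gram vectors are pulled back along a map of vertices. This covers enlarging the matrix, with the
    identity, and both directions between a graph and its quotient. *)
Lemma gram_map (R : realType) a n m (A A' : nat -> nat -> bool) (f : nat -> nat) : gram R a n A ->
  (forall i, i < m -> f i < n) ->
  (forall i j, i < m -> j < m -> A (f i) (f j) -> A' i j) ->
  gram R a m A'.
Proof.
move=> [s Hs] fn AA'; exists [seq v \o f | v <- s] => i j mi mj.
rewrite big_map; apply: le_trans (Hs (f i) (f j) (fn i mi) (fn j mj)) _.
rewrite lerD2r ler_wpM2l // ler_nat.
by case: (A _ _) (AA' i j mi mj) => // ->.
Qed.

Lemma theta_rank0P (R : realType) (G : graph) (A : nat -> nat -> bool) :
  (forall i j : 'I_(Defs.order G), A i j = (i == j) || adj i j) ->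
  theta_rank0 R G <-> gram R (alpha G) (Defs.order G) A.
Proof.
move=> AE; rewrite /theta_rank0; set M := (X in coneK0 X).
have ME i j : M i j = ((alpha G)%:R * (A i j)%:R - 1)%R.
  rewrite !mxE AE; congr (_ * _ - _)%R.
  have [<-|ij] := eqVneq i j; first by rewrite adj_irr add0r.
  by rewrite addr0.
have sM : M^T%R = M.
  apply/matrixP => i j; rewrite mxE !ME !AE.
  by rewrite eq_sym adj_sym.
rewrite coneK0P; split=> [[_ [s Hs]]|[s Hs]].
  (* Vectors on the vertices are extended by 0 to all of [nat]. *)
  exists [seq (fun k => if insub k is Some i then v i else 0%R) | v : 'I_(Defs.order G) -> R <- s].
  move=> i j ni nj; have := Hs (Ordinal ni) (Ordinal nj).
  by rewrite ME big_map; under [X in _ -> (X <= _)%R]eq_bigr do rewrite !insubT.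
split=> //; exists [seq (fun i : 'I_(Defs.order G) => v i) | v : nat -> R <- s] => i j.
by rewrite big_map ME; apply: Hs.
Qed.

(** * The quotient of a saturated matrix by twins *)

Section Quotient.
Variables (R : realType) (G : graph) (n : nat).
Hypothesis nE : Defs.order G = n.
Let a := alpha G.
Hypothesis a_gt0 : 0 < a.
Variables (A0 A : nat -> nat -> bool) (us : seq nat).
Hypothesis A0E : forall i j : 'I_(Defs.order G), A0 i j = (i == j) || adj i j.
Hypothesis A_sym : forall i j, i < n -> j < n -> A i j = A j i.
Hypothesis A_diag : forall i, i < n -> A i i.
Hypothesis A_sub : forall i j, i < n -> j < n -> A i j -> A0 i j.
Hypothesis A_closed : forall i j k S, all (gtn n) [:: i, j, k & S] ->
  size S = a.-1 -> indep A (i :: S) -> indep A (j :: S) -> ~~ A j k -> ~~ A i k.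
Hypothesis A_gram : gram R a n A0 <-> gram R a n A.

(** When the diagonal of the symmetric matrix [A] is full, equal rows mean adjacent vertices with
    the same closed neighbourhood. *)
Definition twin (i j : nat) : bool := all (fun k => A i k == A j k) (iota 0 n).

Hypothesis us_uniq : uniq us.
Hypothesis us_lt : all (gtn n) us.
Hypothesis us_ex : forall i, i < n -> exists2 u, u \in us & twin i u.
Hypothesis us_twin : forall u u', u \in us -> u' \in us -> twin u u' -> u = u'.

Lemma twinP i j : reflect (forall k, k < n -> A i k = A j k) (twin i j).
Proof.
apply: (iffP allP) => [H k kn|H k]; first by apply/eqP/H; rewrite mem_iota.
by rewrite mem_iota => /H ->.
Qed.

Lemma us_gt0 : 0 < size us.
Proof.
have n0 : 0 < n by rewrite -nE; apply: Defs.order_gt0.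
by have [u] := us_ex n0; case: us.
Qed.

Local Notation I := 'I_(size us).

Definition quotient_adj : rel I := fun p q => (p != q) && A (nth 0 us p) (nth 0 us q).

Let u_ (p : I) : nat := nth 0 us p.

Lemma u_lt p : u_ p < n.
Proof. by apply: (allP us_lt); rewrite mem_nth. Qed.

Lemma quotient_adj_sym : ssrbool.symmetric quotient_adj.
Proof. by move=> p q; rewrite /quotient_adj eq_sym A_sym // u_lt. Qed.

Lemma quotient_adj_irr : irreflexive quotient_adj.
Proof. by move=> p; rewrite /quotient_adj eqxx. Qed.

Definition quotient : graph := Graph us_gt0 quotient_adj_sym quotient_adj_irr.

Definition class (i : nat) : nat := find (twin i) us.

Lemma class_lt i : i < n -> class i < size us.
Proof. by move=> /us_ex [u uus iu]; rewrite -has_find; apply/hasP; exists u. Qed.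

Lemma class_A i j : i < n -> j < n ->
  A (nth 0 us (class i)) (nth 0 us (class j)) = A i j.
Proof.
move=> ni nj; have ci := class_lt ni; have cj := class_lt nj.
have /twinP ti : twin i (nth 0 us (class i)) by apply: nth_find; rewrite has_find.
have /twinP tj : twin j (nth 0 us (class j)) by apply: nth_find; rewrite has_find.
have uc := u_lt (Ordinal cj).
by rewrite -ti // A_sym // -tj // A_sym.
Qed.

Lemma quotient_nonadjE (p q : 'I_(Defs.order quotient)) : nonadj p q = ~~ A (u_ p) (u_ q).
Proof.
rewrite /nonadj /= /quotient_adj -/(u_ p) -/(u_ q).
by have [->|_] := eqVneq p q; rewrite ?A_diag ?u_lt.
Qed.

Lemma indep_quotient (s : seq 'I_(Defs.order quotient)) :
  pairwise (@nonadj quotient) s = indep A (map u_ s).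
Proof.
rewrite /indep pairwise_map; apply: eq_pairwise => p q.
exact: quotient_nonadjE.
Qed.

(** An independent set of size [a + 1] would let the closure rule clear a diagonal entry. Conversely
    a maximum stable set of [G] stays independent after deletions, and its vertices fall into
    distinct classes because the diagonal is full. *)
Lemma alpha_quotient : alpha quotient = a.
Proof.
apply/eqP; rewrite eqn_leq; apply/andP; split.
  rewrite leqNgt; apply/negP => lt.
  have [S /stable_nonadj] := alpha_witness quotient.
  rewrite indep_quotient cardE -[X in _ -> X = _ -> _](size_map u_).
  have : all (gtn n) (map u_ (enum S)).
    by apply/allP => _ /mapP[p _ ->]; apply: u_lt.
  move: (map u_ _) => s sn si sz; rewrite -sz in lt.
  have {sz}: indep A (take a.+1 s).
    by apply: subseq_pairwise si; apply: take_subseq.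
  have : all (gtn n) (take a.+1 s) by apply/allP => x /mem_take; apply: allP.
  have : size (take a.+1 s) = a.+1 by rewrite size_take_min; apply/minn_idPl.
  case: (take a.+1 s) => [|i [|j S']] //=; first by move=> [a0]; move: a_gt0; rewrite -a0.
  move=> [zS] nS; rewrite /indep /= => /and3P[/andP[ij iS] jS sS].
  case/and3P: nS => ni nj nS.
  (* The rule with [k = i]: as [j] is not adjacent to [i], it denies the entry [A i i]. *)
  have := @A_closed i j i S'; rewrite /= A_diag //.
  rewrite /indep /= iS jS sS [A j i]A_sym // ij -zS ni nj nS /=.
  by move=> /(_ isT erefl isT isT isT).
have [S /stable_nonadj pS cS] := alpha_witness G.
rewrite /a -cS cardE.
pose c (i : 'I_(Defs.order G)) : 'I_(Defs.order quotient) :=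
  Ordinal (class_lt (leq_trans (ltn_ord i) (eq_leq nE))).
rewrite -(size_map c); apply: nonadj_seq_leq_alpha.
rewrite pairwise_map; apply: sub_pairwise pS => i j /andP[ij nij].
have ni : i < n by rewrite -nE.
have nj : j < n by rewrite -nE.
rewrite /= quotient_nonadjE /u_ /= class_A //.
by apply: contra (A_sub ni nj) _; rewrite A0E negb_or ij.
Qed.

(** A stable set of size [a + 1] after deleting [pq] contains [p] and [q]; the remaining [a - 1]
    vertices form the set [S] of the closure rule. Applied in both directions, the rule equates the
    rows of [p] and [q], while distinct representatives are never twins. *)
Lemma quotient_no_critical : no_critical_edge quotient.
Proof.
move=> p q [pq]; rewrite alpha_quotient => aS.
have [S /stableP SS cS] := alpha_witness (del_edge p q).
rewrite aS in cS.
have nonadjS x y : x \in S -> y \in S -> [set x; y] != [set p; q] -> @adj quotient x y = false.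
  by move=> xS yS xy; have := SS x y xS yS; rewrite /= /del_edge_adj xy andbT => /negPf.
have pqS : (p \in S) && (q \in S).
  apply/negPn/negP => H.
  have: stable (S : {set 'I_(Defs.order quotient)}).
    apply/stableP => x y xS yS; rewrite nonadjS //.
    apply: contraNneq H => E.
    have : [set p; q] \subset S by rewrite -E subUset !sub1set xS yS.
    by rewrite subUset !sub1set.
  by move/stable_leq_alpha; rewrite alpha_quotient cS ltnn.
have /andP[pS qS] := pqS.
have npq : p != q by apply: contraTneq pq => ->; rewrite adj_irr.
pose L := enum (S :\: [set p; q]).
have szL : size L = a.-1.
  rewrite -cardE cardsD (setIidPr _); last by rewrite subUset !sub1set pS qS.
  by rewrite cS cards2 npq subSS subn1.
have indepL x : x \in [:: p; q] -> indep A (map u_ (x :: L)).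
  move=> xpq; rewrite -indep_quotient.
  have xL : x \notin L by rewrite mem_enum !inE; move: xpq; rewrite !inE => ->.
  apply: pairwise_uniq_in => /=; first by rewrite xL enum_uniq.
  have Sx y : y \in x :: L -> y \in S.
    rewrite inE => /orP[/eqP ->|]; first by move: xpq; rewrite !inE => /orP[] /eqP ->.
    by rewrite mem_enum inE => /andP[].
  move=> y z yL zL yz; apply/andP; split=> //; apply/negP.
  rewrite nonadjS ?Sx //; apply: contra_neq yz => E.
  have inpq w : w \in x :: L -> w \in [set p; q] -> w = x.
    by rewrite inE => /orP[/eqP //|]; rewrite mem_enum in_setD => /andP[/negPf ->].
  have yx : y = x by apply: inpq yL _; rewrite -E set21.
  have zx : z = x by apply: inpq zL _; rewrite -E set22.
  by rewrite yx zx.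
have tw : twin (u_ p) (u_ q).
  apply/twinP => k kn.
  have cl x y : x \in [:: p; q] -> y \in [:: p; q] -> ~~ A (u_ y) k -> ~~ A (u_ x) k.
    move=> xpq ypq; apply: (@A_closed _ _ _ (map u_ L)); rewrite ?size_map //=; last first.
    - exact: (indepL y).
    - exact: (indepL x).
    by rewrite !u_lt kn; apply/allP => _ /mapP[z _ ->]; apply: u_lt.
  apply/idP/idP; apply: contraLR.
    by apply: cl; rewrite !inE eqxx ?orbT.
  by apply: cl; rewrite !inE eqxx ?orbT.
case/eqP: npq; apply/val_inj/eqP.
rewrite -(nth_uniq 0 _ _ us_uniq) ?ltn_ord //; apply/eqP.
exact: (us_twin (mem_nth 0 (ltn_ord p)) (mem_nth 0 (ltn_ord q)) tw).
Qed.

(** Choosing a representative and taking the class are vertex maps preserving [A], so Gram vectors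
    can be pulled back along either. *)
Lemma theta_rank0_quotient : theta_rank0 R G <-> theta_rank0 R quotient.
Proof.
pose B p q := A (nth 0 us p) (nth 0 us q).
rewrite (theta_rank0P R A0E) (@theta_rank0P R quotient B); last first.
  move=> p q; rewrite /= /quotient_adj /B.
  by have [->|] := eqVneq p q => //=; rewrite A_diag // u_lt.
rewrite alpha_quotient nE A_gram; split=> H.
  apply: (gram_map (f := nth 0 us) H) => // i ism.
  exact: (u_lt (Ordinal ism)).
apply: (gram_map (f := class) H) => [i|i j ni nj]; first exact: class_lt.
by rewrite /B class_A.
Qed.

Lemma quotient_correct : correct_answer R a G (Some quotient).
Proof.
split; [exact: quotient_no_critical|exact: alpha_quotient|exact: theta_rank0_quotient].
Qed.

End Quotient.

(** * Saturation as a loop program *)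

Lemma nth_ltn n r x : 0 < n -> all (gtn n) r -> nth 0 r x < n.
Proof.
move=> n0 rn; case: (ltnP x (size r)) => xr; last by rewrite nth_default.
by apply: (allP rn); rewrite mem_nth.
Qed.

(** * Loop invariants and the termination measure *)

Section Denotation.
Variable n : nat.
Implicit Types (r : seq nat) (c : prog) (s : store).

Lemma iota0S m : iota 0 m.+1 = rcons (iota 0 m) m.
Proof. by rewrite -addn1 iotaD cats1. Qed.

Lemma den_for_ind (P : nat -> store -> Prop) r c s : P 0 s ->
  (forall i s, i < n -> P i s -> P i.+1 (den n (rcons r i) c s)) ->
  P n (den n r (PFor c) s).
Proof.
move=> P0 PS.
suff H m : m <= n -> P m (foldl (fun s i => den n (rcons r i) c s) s (iota 0 m)).
  exact: H.
elim: m => // m IH mn.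
by rewrite iota0S foldl_rcons; apply: PS => //; apply: IH; apply: ltnW.
Qed.

Lemma den_for_emit r c s (g : nat -> seq bool) :
  (forall i s', i < n -> mat s' = mat s ->
     den n (rcons r i) c s' = Store (mat s) (out s' ++ g i)) ->
  den n r (PFor c) s = Store (mat s) (out s ++ flatten [seq g i | i <- iota 0 n]).
Proof.
move=> H; apply: (@den_for_ind (fun i s' =>
  s' = Store (mat s) (out s ++ flatten [seq g i | i <- iota 0 i]))).
  by rewrite cats0; case: s {H}.
move=> i _ ni ->; rewrite H // iota0S map_rcons flatten_rcons.
by rewrite catA.
Qed.

Definition fors m c := iter m PFor c.

Lemma den_fors_inv m r c (P : store -> Prop) s :
  (forall l s, size l = m -> all (gtn n) l -> P s -> P (den n (r ++ l) c s)) ->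
  P s -> P (den n r (fors m c) s).
Proof.
elim: m r s => [|m IH] r s H Ps.
  by have := H [::] s erefl isT Ps; rewrite cats0.
apply: (@den_for_ind (fun _ => P)) => // i s' ni; apply: IH => l s2 zl ln.
by rewrite cat_rcons; apply: H; rewrite /= ?zl ?ni.
Qed.

Definition weight s : nat := \sum_(x < n) \sum_(y < n) mat s true x y.

(** A step that changes the store must erase an entry, so at most [n * n] steps do change it. *)
Definition shrinking (f : store -> store) : Prop :=
  forall s, f s = s \/ weight (f s) < weight s.

Lemma shrinking_leq f s : shrinking f -> weight (f s) <= weight s.
Proof. by move=> /(_ s) [-> //|/ltnW]. Qed.

(** A loss of weight is never recovered. Hence a composite that fixes the store is made of steps
    each of which fixes it. *)
Lemma shrinking_foldl (F : store -> nat -> store) (l : seq nat) :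
  (forall i, i \in l -> shrinking (F^~ i)) ->
  shrinking (fun s => foldl F s l) /\
  (forall s, foldl F s l = s -> forall i, i \in l -> F s i = s).
Proof.
elim: l => [|i l IH] H /=; first by split=> // s; left.
have [IH1 IH2] := IH (fun j jl => H j (@mem_behead _ (i :: l) j jl)).
have Hi : shrinking (F^~ i) by apply: H; rewrite mem_head.
split=> [s|s E j].
  case: (Hi s) => [->|lt]; first exact: IH1.
  by right; apply: leq_ltn_trans (shrinking_leq _ IH1) lt.
have Ei : F s i = s.
  case: (Hi s) => // lt; have := shrinking_leq (F s i) IH1; rewrite /= E.
  by rewrite leqNgt lt.
by rewrite Ei in E; rewrite inE => /orP[/eqP -> //|jl]; apply: IH2.
Qed.

Lemma shrinking_fors m r c :
  (forall l, size l = m -> all (gtn n) l -> shrinking (den n (r ++ l) c)) ->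
  shrinking (den n r (fors m c)) /\
  (forall s, den n r (fors m c) s = s ->
   forall l, size l = m -> all (gtn n) l -> den n (r ++ l) c s = s).
Proof.
elim: m r => [|m IH] r H /=.
  split; first by have := H [::] erefl isT; rewrite cats0.
  by move=> s E [] // _ _; rewrite cats0.
have Hi i : i \in iota 0 n -> forall l, size l = m -> all (gtn n) l ->
    shrinking (den n (rcons r i ++ l) c).
  rewrite mem_iota => ni l zl ln; rewrite cat_rcons; apply: H; rewrite /= ?zl //.
  by rewrite ln andbT.
have [H1 H2] := @shrinking_foldl (fun s i => den n (rcons r i) (fors m c) s)
  (iota 0 n) (fun i ni => proj1 (IH _ (Hi i ni))).
split=> // s E [|i l] //= [zl] /andP[ni ln]; rewrite -cat_rcons.
have nii : i \in iota 0 n by rewrite mem_iota.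
exact: (proj2 (IH _ (Hi i nii)) _ (H2 s E i nii)).
Qed.

Lemma set_mat_id q i j b s : mat s q i j = b -> set_mat q i j b s = s.
Proof.
case: s => M o <-; congr Store; apply: functional_extensionality => q'.
apply: functional_extensionality => x; apply: functional_extensionality => y.
by rewrite /=; case: and3P => // -[/eqP -> /eqP -> /eqP ->].
Qed.

Lemma shrinking_clear i j : i < n -> j < n -> shrinking (set_mat true i j false).
Proof.
move=> ni nj s; case E: (mat s true i j); last by left; apply: set_mat_id.
right; rewrite /weight.
rewrite (bigD1 (Ordinal ni)) //= (bigD1 (Ordinal nj)) //= !eqxx /= add0n.
rewrite [X in _ < X](bigD1 (Ordinal ni)) //= [X in _ < X + _](bigD1 (Ordinal nj)) //= E.
rewrite add1n addSn ltnS leq_add //.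
  by apply: leq_sum => y _; case: ifP.
by apply: leq_sum => x _; apply: leq_sum => y _; case: ifP.
Qed.

End Denotation.

(** Applied to lists of loop levels, this lists the matrix tests that express [indep] inside a
    program. *)
Fixpoint pairs (L : seq nat) : seq (nat * nat) :=
  if L is x :: L' then [seq (x, y) | y <- L'] ++ pairs L' else [::].

Lemma all_pairs (A : nat -> nat -> bool) (f : nat -> nat) (L : seq nat) :
  all (fun p => ~~ A (f p.1) (f p.2)) (pairs L) = indep A (map f L).
Proof.
elim: L => //= x L IH; rewrite all_cat IH /indep /= all_map.
by rewrite [in RHS]all_map.
Qed.

Definition guard (l : seq (nat * nat)) (c : prog) : prog :=
  foldr (fun p c => PIf true p.1 p.2 PSkip c) c l.

Lemma den_guard n r l c s : den n r (guard l c) s =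
  if all (fun p => ~~ mat s true (nth 0 r p.1) (nth 0 r p.2)) l
  then den n r c s else s.
Proof. by elim: l => //= p l ->; case: (mat s true _ _). Qed.

Lemma wf_guard K d l c : wf K d (guard l c) =
  all (fun p => (p.1 < K) && (p.2 < K)) l && wf K d c.
Proof. by elim: l => //= p l ->; rewrite -!andbA. Qed.

Lemma wf_fors K d m c : wf K d (fors m c) = ((m == 0) || (d + m <= K)) && wf K (d + m) c.
Proof.
elim: m d => [|m IH] d /=; first by rewrite addn0.
rewrite IH addSnnS andbA; congr (_ && _).
by case: m {IH} => [|m] /=; rewrite ?addn1 ?andbT // andb_idl //; lia.
Qed.

Lemma all_pairs_lt K L : all (gtn K) L -> all (fun p => (p.1 < K) && (p.2 < K)) (pairs L).
Proof.
elim: L => //= x L IH /andP[xK LK]; rewrite all_cat IH // andbT all_map.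
by apply/allP => y yL /=; rewrite xK; apply: (allP LK).
Qed.

Arguments pairs : simpl never.

(** * Saturation terminates and preserves Gram vectors *)

Section Merge.
Variables (R : realType) (a n : nat).
Hypotheses (a_gt0 : 0 < a) (n_gt0 : 0 < n).

(* At levels 2, 3, 4, ..., a + 2, a + 3: the vertices i, j, the set S, and k. *)
Definition merge_body : prog :=
  guard ((3, a + 3) :: pairs (2 :: iota 4 a.-1) ++ pairs (3 :: iota 4 a.-1))
    (PSeq (PSet true 2 (a + 3) false) (PSet true (a + 3) 2 false)).

(* The two outer loops repeat the pass over all (i, j, S, k) [n * n] times. *)
Definition merge : prog := fors 2 (fors (a + 2) merge_body).

Definition closed (A : nat -> nat -> bool) : Prop :=
  forall i j k S, all (gtn n) [:: i, j, k & S] -> size S = a.-1 ->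
    indep A (i :: S) -> indep A (j :: S) -> ~~ A j k -> ~~ A i k && ~~ A k i.

Lemma den_merge_body r s : den n r merge_body s =
  let A := mat s true in
  let S := map (nth 0 r) (iota 4 a.-1) in
  let i := nth 0 r 2 in let j := nth 0 r 3 in let k := nth 0 r (a + 3) in
  if [&& ~~ A j k, indep A (i :: S) & indep A (j :: S)]
  then set_mat true k i false (set_mat true i k false s) else s.
Proof. by rewrite den_guard /= all_cat !all_pairs. Qed.

Lemma shrinking_merge_body r : all (gtn n) r -> shrinking n (den n r merge_body).
Proof.
move=> rn s; rewrite den_merge_body /=.
case: ifP => _; last by left.
have i_n := nth_ltn 2 n_gt0 rn; have k_n := nth_ltn (a + 3) n_gt0 rn.
have [->|lt] := shrinking_clear i_n k_n s; first exact: shrinking_clear.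
right; apply: leq_ltn_trans lt.
exact: shrinking_leq (shrinking_clear k_n i_n).
Qed.

(** [x] and [y] are the counters of the repetition, which the body ignores. A pass that fixes the
    store fixes it in each instance of the body, and such an instance is one case of the closure
    rule. *)
Lemma closed_fixed x y s : x < n -> y < n ->
  den n [:: x; y] (fors (a + 2) merge_body) s = s <-> closed (mat s true).
Proof.
move=> xn yn.
have sh l : size l = a + 2 -> all (gtn n) l -> shrinking n (den n ([:: x; y] ++ l) merge_body).
  by move=> _ ln; apply: shrinking_merge_body; rewrite /= xn yn.
have [_ fx] := shrinking_fors sh.
split=> [/fx H i j k S|cl].
  move=> nS zS iS jS jk.
  move: (nS) => /= /and4P[ni nj nk nSS].
  have zl : size [:: i, j & rcons S k] = a + 2 by rewrite /= size_rcons zS; lia.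
  have nl : all (gtn n) [:: i, j & rcons S k] by rewrite /= all_rcons ni nj /= nk.
  have := H _ zl nl; rewrite den_merge_body /=.
  have -> : nth 0 [:: x, y, i, j & rcons S k] (a + 3) = k.
    rewrite (_ : a + 3 = (size S).+4); last lia.
    by rewrite /= nth_rcons ltnn eqxx.
  have -> : [seq nth 0 [:: x, y, i, j & rcons S k] i0 | i0 <- iota 4 a.-1] = S.
    rewrite (iotaDl 4 0) -map_comp -zS -[RHS](mkseq_nth 0) /mkseq; apply/eq_in_map => t.
    by rewrite mem_iota /= => tS; rewrite nth_rcons tS.
  (* [E] says that clearing the entries [ik] and [ki] does not change the store, so both are already
     0. *)
  rewrite /indep /= in iS jS *; rewrite iS jS jk /= => E; rewrite -E /= !eqxx /=.
  by rewrite andbT; case: ifP.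
apply: (@den_fors_inv n (a + 2) _ _ (fun s' => s' = s)) => // l _ zl ln ->.
have : all (gtn n) ([:: x; y] ++ l) by rewrite /= xn yn.
move: (_ ++ _) => r rn {l zl ln}; rewrite den_merge_body /=.
case: and3P => // -[jk iS jS].
have /andP[ik ki] : ~~ mat s true (nth 0 r 2) (nth 0 r (a + 3)) &&
                    ~~ mat s true (nth 0 r (a + 3)) (nth 0 r 2).
  apply: cl iS jS jk; last by rewrite size_map size_iota.
  rewrite /= !(nth_ltn _ n_gt0 rn); apply/allP => _ /mapP[t _ ->].
  exact: (nth_ltn t n_gt0 rn).
by rewrite (set_mat_id (negPf ik)) (set_mat_id (negPf ki)).
Qed.

(** After [t] passes the matrix is closed or at least [t] entries below [n * n] remain out of use.
    For [t = n * n] the second case leaves the zero matrix, which is closed trivially. *)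
Lemma merge_closed s : closed (mat (den n [::] merge s) true).
Proof.
pose P (t : nat) s := closed (mat s true) \/ weight n s + t <= n * n.
have PS x y t s' : x < n -> y < n -> P t s' ->
    P t.+1 (den n [:: x; y] (fors (a + 2) merge_body) s').
  move=> xn yn [cl|le]; first by left; rewrite (proj2 (closed_fixed _ xn yn)).
  have sh : shrinking n (den n [:: x; y] (fors (a + 2) merge_body)).
    have [|//] := @shrinking_fors n (a + 2) [:: x; y] merge_body.
    by move=> l _ ln; apply: shrinking_merge_body; rewrite /= xn yn.
  case: (sh s') => [E|lt]; last by right; lia.
  by left; rewrite E; apply/(closed_fixed _ xn yn).
have : P (n * n) (den n [::] merge s).
  apply: (@den_for_ind n (fun x => P (x * n))).
    right; rewrite addn0 /weight.
    apply: (@leq_trans (\sum_(x < n) \sum_(y < n) 1)).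
      by do 2!apply: leq_sum => ? _; apply: leq_b1.
    by rewrite !sum_nat_const !card_ord muln1.
  move=> x s' xn Px; rewrite mulSn addnC.
  apply: (@den_for_ind n (fun y => P (x * n + y))); first by rewrite addn0.
  by move=> y s2 yn; rewrite addnS; apply: PS.
case=> // w0 i j k S /= /and4P[ni nj nk _] _ _ _ _.
have {}w0 : weight n (den n [::] merge s) = 0 by lia.
have z x y : x < n -> y < n -> ~~ mat (den n [::] merge s) true x y.
  move=> xn yn; move/eqP: w0; rewrite /weight sum_nat_eq0 => /forallP /(_ (Ordinal xn)).
  rewrite sum_nat_eq0 => /forallP /(_ (Ordinal yn)) /=.
  by case: (mat _ _ _ _).
by rewrite !z.
Qed.

(** The last clause keeps the same vectors [vs], which is stronger than preserving [gram] and is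
    what passes through each deletion. *)
Definition below (A0 : nat -> nat -> bool) (A : nat -> nat -> bool) : Prop :=
  [/\ forall x y, x < n -> y < n -> A x y -> A0 x y,
      forall x y, x < n -> y < n -> A x y = A y x &
      forall vs, dominates (R := R) a n A0 vs -> dominates (R := R) a n A vs].

Lemma merge_below A0 s : below A0 (mat s true) ->
  let s' := den n [::] merge s in
  [/\ below A0 (mat s' true), mat s' false = mat s false & out s' = out s].
Proof.
move=> B0; pose P s' := [/\ below A0 (mat s' true), mat s' false = mat s false & out s' = out s].
change (P (den n [::] merge s)).
apply: (den_fors_inv (P := P)) => // l s1 _ ln P1.
apply: (den_fors_inv (P := P)) => // l' s2 _ ln' [[B1 B2 B3] D2 O2] {s1 P1}.
have rn : all (gtn n) (([::] ++ l) ++ l') by rewrite all_cat ln.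
move: (([::] ++ l) ++ l') rn => r rn {l l' ln ln'}.
rewrite den_merge_body /=; case: and3P => [[jk iS jS]|_]; last by [].
split=> //; move: jk iS jS.
set i := nth 0 _ 2; set j := nth 0 _ 3; set k := nth 0 _ _; set S := map _ _ => jk iS jS.
have [ni nj nk] : [/\ i < n, j < n & k < n] by split; apply: nth_ltn.
have nS : all (gtn n) S by apply/allP => _ /mapP[t _ ->]; apply: (nth_ltn t n_gt0 rn).
split=> /= [x y nx ny|x y nx ny|vs Hvs x y nx ny].
- by case: ifP => // _; case: ifP => // _; apply: B1.
- rewrite B2 // andbC [(y == k) && _]andbC; rewrite ![(_ == i) && _]andbC.
  by do 2!case: ifP => //.
- have Hs := B3 vs Hvs.
  have Eik : (\sum_(v <- vs) v i * v k <= -1)%R.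
    apply: (dominates_merge Hs B2 a_gt0 _ iS jS) => //=.
      by rewrite ni nj nk.
    by rewrite size_map size_iota.
  case: ifP => [/andP[/eqP-> /eqP->]|_].
    rewrite mulr0 sub0r; under eq_bigr do rewrite mulrC.
    exact: Eik.
  case: ifP => [/andP[/eqP-> /eqP->]|_]; first by rewrite mulr0 sub0r.
  exact: Hs.
Qed.

End Merge.

Lemma wf_merge a K : a + 4 <= K -> wf K 0 (merge a).
Proof.
move=> aK; rewrite /merge !wf_fors wf_guard.
have P x : x < 4 -> all (fun p => (p.1 < K) && (p.2 < K)) (pairs (x :: iota 4 a.-1)).
  move=> x4; apply: all_pairs_lt => /=; apply/andP; split; first lia.
  by apply/allP => y; rewrite mem_iota /=; lia.
have := P 2 isT; have := P 3 isT; move: (pairs _) (pairs _) => p3 p2 h3 h2.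
rewrite /= all_cat h2 h3; lia.
Qed.

(** * The reduction *)

Definition fill_diag (q b : bool) : prog := PFor (PSet q 0 0 b).

(** The scratch diagonal is already 1 when this runs, so a scratch entry ends up 0 exactly for a
    pair of distinct twins. *)
Definition compare_rows : prog :=
  PFor (PFor (PFor (PIf true 0 2 (PIf true 1 2 PSkip (PSet false 0 1 true))
                                 (PIf true 1 2 (PSet false 0 1 true) PSkip)))).

(* Level 1 is unbound here, so the flag is the entry (0, 0). *)
Definition check_diag : prog := PFor (PIf true 0 0 PSkip (PSet false 1 1 false)).

(** Once the diagonal of the graph matrix is known to be full, it carries no information and is
    reused to mark surviving vertices. A vertex dies only in favour of a living twin, so no class
    dies out. *)
Definition kill_twins : prog :=
  PFor (PFor (PIf false 0 1 PSkip (PIf true 1 1 (PSet true 0 0 false) PSkip))).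

(** The leading bit announces a graph. The entries are masked by the scratch matrix, whose diagonal
    is 0 by then, because the graph matrix still has ones on the diagonal at survivors. *)
Definition emit_graph : prog :=
  PSeq (PEmit true)
 (PSeq (PFor (PIf true 0 0 (PEmit true) PSkip))
 (PSeq (PEmit false)
       (PFor (PIf true 0 0
          (PFor (PIf true 1 1
             (PIf true 0 1 (PIf false 0 1 (PEmit true) (PEmit false)) (PEmit false))
             PSkip))
          PSkip)))).

Definition reduction (a : nat) : prog :=
  PSeq (fill_diag true true)
 (PSeq (merge a)
 (PSeq (fill_diag false true)
 (PSeq compare_rows
 (PSeq check_diag
       (PIf false 0 0
          (PSeq kill_twins (PSeq (fill_diag false false) emit_graph))
          (PEmit false)))))).

Lemma wf_reduction a : wf (a + 4) 0 (reduction a).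
Proof.
have := wf_merge (leqnn (a + 4)).
by rewrite /reduction /= => ->; lia.
Qed.

(** * The effect of each pass *)

Section Steps.
Variable n : nat.
Hypothesis n_gt0 : 0 < n.
Implicit Types s : store.

Lemma den_fill_diag q b s (s' := den n [::] (fill_diag q b) s) :
  (forall q' x y, x < n -> mat s' q' x y = if (q' == q) && (x == y) then b else mat s q' x y)
  /\ out s' = out s.
Proof.
suff [H1 H2] : (forall q' x y, mat s' q' x y =
    if [&& q' == q, x == y & x < n] then b else mat s q' x y) /\ out s' = out s.
  by split=> // q' x y xn; rewrite H1 xn andbT.
apply: (@den_for_ind n (fun i s' => (forall q' x y, mat s' q' x y =
    if [&& q' == q, x == y & x < i] then b else mat s q' x y) /\ out s' = out s)).
  by split=> // q' x y; rewrite ltn0 !andbF.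
move=> i s1 ni [H1 H2]; split=> // q' x y /=; rewrite H1 ltnS [x <= i]leq_eqVlt.
case: (q' == q) => //=; case: (eqVneq x i) => [->|xi] //=.
by rewrite (eq_sym y); case: (i == y).
Qed.

Lemma den_compare_rows s (s' := den n [::] compare_rows s) :
  [/\ forall x y, x < n -> y < n ->
        mat s' false x y = mat s false x y || ~~ twin n (mat s true) x y,
      mat s' true = mat s true & out s' = out s].
Proof.
set A := mat s true.
(* [p] records the pairs already treated. *)
pose P (p : nat -> nat -> bool) s' := [/\ forall x y,
    mat s' false x y = mat s false x y || p x y && ~~ twin n A x y, mat s' true = A & out s' = out s].
suff [H1 H2 H3] : P (fun x y => (x < n) && (y < n)) s'.
  by split=> // x y xn yn; rewrite H1 xn yn.
apply: (@den_for_ind n (fun i => P (fun x y => (x < i) && (y < n)))).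
  by split=> // x y; rewrite orbF.
move=> i s1 ni P1.
have ext p p' s2 : P p s2 -> p =2 p' -> P p' s2.
  by move=> [H1 H2 H3] E; split=> // x y; rewrite H1 E.
apply: (ext (fun x y => (x < i) && (y < n) || (x == i) && (y < n))); last first.
  by move=> x y; rewrite -andb_orl orbC -leq_eqVlt.
apply: (@den_for_ind n (fun j => P (fun x y => (x < i) && (y < n) || (x == i) && (y < j)))).
  by apply: ext P1 _ => x y; rewrite ltn0 andbF orbF.
move=> j {P1}s1 nj P1.
pose Q k s2 := [/\ forall x y, mat s2 false x y = mat s1 false x y ||
    [&& x == i, y == j & ~~ all (fun l => A i l == A j l) (iota 0 k)],
    mat s2 true = A & out s2 = out s].
have [Q1 Q2 Q3] : Q n (den n [:: i; j]
    (PFor (PIf true 0 2 (PIf true 1 2 PSkip (PSet false 0 1 true))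
                        (PIf true 1 2 (PSet false 0 1 true) PSkip))) s1).
  apply: den_for_ind; first by case: P1; split=> // x y; rewrite !andbF orbF.
  move=> k s2 nk [Q1 Q2 Q3] /=.
  have -> : (if mat s2 true i k then if mat s2 true j k then s2 else set_mat false i j true s2
             else if mat s2 true j k then set_mat false i j true s2 else s2) =
            if A i k == A j k then s2 else set_mat false i j true s2.
    by rewrite Q2; case: (A i k); case: (A j k).
  rewrite /Q iota0S all_rcons; case: (A i k == A j k) => /=; first by split.
  split=> //= x y; rewrite Q1 andbT.
  by case: (x == i); case: (y == j); rewrite ?orbT ?orbF.
case: P1 => H1 H2 H3; split=> // x y; rewrite Q1 H1 -orbA; congr (_ || _).
rewrite ltnS [y <= j]leq_eqVlt.
case: (eqVneq x i) => [->|xi]; rewrite ?andbF ?orbF //=.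
case: (eqVneq y j) => [->|yj]; rewrite ?andbF ?orbF ?ltnn //=.
Qed.

Lemma den_check_diag s (s' := den n [::] check_diag s) :
  [/\ forall x y, mat s' false x y = mat s false x y &&
        ([&& x == 0 & y == 0] ==> all (fun i => mat s true i i) (iota 0 n)),
      mat s' true = mat s true & out s' = out s].
Proof.
apply: (@den_for_ind n (fun i s' => [/\ forall x y, mat s' false x y = mat s false x y &&
        ([&& x == 0 & y == 0] ==> all (fun i => mat s true i i) (iota 0 i)),
      mat s' true = mat s true & out s' = out s])).
  by split=> // x y; rewrite implybT andbT.
move=> i s1 ni [H1 H2 H3]; rewrite iota0S all_rcons /= H2.
case: (mat s true i i) => /=; first by split.
split=> //= x y; rewrite H1.
by case: ((x == 0) && (y == 0)); rewrite ?andbF.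
Qed.

(** The invariant has two halves: every vertex keeps a living twin, and among the pairs already
    treated no two distinct living vertices are twins. Deaths are never undone, so treated pairs
    stay correct. *)
Lemma den_kill_twins s (A := mat s true) (s' := den n [::] kill_twins s) :
  (forall i, i < n -> A i i) ->
  (forall x y, x < n -> y < n -> mat s false x y = (x == y) || ~~ twin n A x y) ->
  [/\ mat s' false = mat s false, out s' = out s,
      forall x y, x != y -> mat s' true x y = A x y,
      forall x, x < n -> exists u, [/\ u < n, mat s' true u u & twin n A x u] &
      forall x y, x < n -> y < n -> twin n A x y ->
        mat s' true x x -> mat s' true y y -> x = y].
Proof.
move=> Ad DE.
pose P (p : nat -> nat -> bool) s' := [/\ mat s' false = mat s false, out s' = out s,
      forall x y, x != y -> mat s' true x y = A x y,
      forall x, x < n -> exists u, [/\ u < n, mat s' true u u & twin n A x u] &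
      forall x y, x < n -> y < n -> p x y -> twin n A x y ->
        mat s' true x x -> mat s' true y y -> x = y].
suff [H1 H2 H3 H4 H5] : P (fun x y => (x < n)) s'.
  by split=> // x y nx ny; apply: H5.
have twin_refl x : twin n A x x by apply/twinP.
apply: (@den_for_ind n (fun i => P (fun x y => x < i))).
  by split=> // x nx; exists x; rewrite nx -/A Ad.
move=> i s1 ni [H1 H2 H3 H4 H5].
have : P (fun x y => (x < i) || (x == i) && (y < n)) (den n [:: i]
   (PFor (PIf false 0 1 PSkip (PIf true 1 1 (PSet true 0 0 false) PSkip))) s1).
  apply: (@den_for_ind n (fun j => P (fun x y => (x < i) || (x == i) && (y < j)))).
    by split=> // x y nx ny; rewrite ltn0 andbF orbF; apply: H5.
  move=> j {H1 H2 H3 H4 H5}s1 nj [H1 H2 H3 H4 H5] /=.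
  have old x y : (x < i) || (x == i) && (y < j.+1) ->
      (x < i) || (x == i) && (y < j) \/ x = i /\ y = j.
    case/orP => [->|/andP[/eqP ->]]; first by left.
    rewrite ltnS leq_eqVlt => /orP[/eqP ->|->]; first by right.
    by left; rewrite eqxx orbT.
  rewrite H1 DE //; case: (boolP (_ || _)) => [D|].
    split=> // x y nx ny /old[|[-> ->]]; first exact: H5.
    by move=> t; case/orP: D => [/eqP -> //|]; rewrite t.
  rewrite negb_or negbK => /andP[ij tij].
  case: ifP => jj; last first.
    by split=> // x y nx ny /old[|[-> ->]]; [exact: H5|rewrite jj].
  split=> //= [x y xy|x nx|x y nx ny].
  - by case: andP => [[/eqP xi /eqP yi]|_]; [rewrite xi yi eqxx in xy|exact: H3].
  - have [u [un ua tu]] := H4 x nx.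
    (* If the living twin of [x] is the vertex [i] that dies now, [j] takes its place by
       transitivity. *)
    case: (eqVneq u i) => [ui|ui].
      exists j; rewrite nj [j == i]eq_sym (negPf ij) /=; split=> //.
      apply/twinP => k kn; have /twinP -> // := tu; rewrite ui.
      by have /twinP -> := tij.
    by exists u; rewrite un (negPf ui).
  - case: (eqVneq x i) => [->|xi]; first by [].
    case: (eqVneq y i) => [->|yi] //=.
    by rewrite orbF => xlt; apply: H5 => //; rewrite xlt.
case=> K1 K2 K3 K4 K5; split=> // x y nx ny.
by rewrite ltnS leq_eqVlt => xi; apply: K5 => //; rewrite ny andbT orbC.
Qed.

Lemma flatten_if (T : Type) (p : pred nat) (g : nat -> seq T) (l : seq nat) :
  flatten [seq (if p i then g i else [::]) | i <- l] = flatten [seq g i | i <- l & p i].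
Proof. by elim: l => //= i l ->; case: ifP. Qed.

Lemma flatten_nseq (T U : Type) (x : T) (l : seq U) :
  flatten [seq [:: x] | i <- l] = nseq (size l) x.
Proof. by elim: l => //= i l ->. Qed.

Lemma den_emit_graph s (us := [seq i <- iota 0 n | mat s true i i]) :
  out (den n [::] emit_graph s) = out s ++
    true :: nseq (size us) true ++
      false :: [seq mat s true i j && mat s false i j | i <- us, j <- us].
Proof.
have E1 := @den_for_emit n [::] (PIf true 0 0 (PEmit true) PSkip) (emit true s)
  (fun i => if mat s true i i then [:: true] else [::]).
have E2 s1 : mat s1 = mat s -> _ := fun e => @den_for_emit n [::] (PIf true 0 0
          (PFor (PIf true 1 1
             (PIf true 0 1 (PIf false 0 1 (PEmit true) (PEmit false)) (PEmit false))
             PSkip))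
          PSkip) s1
  (fun i => if mat s true i i then
     flatten [seq (if mat s true j j then [:: mat s true i j && mat s false i j] else [::])
             | j <- iota 0 n] else [::]).
have den_seq r c1 c2 s1 : den n r (PSeq c1 c2) s1 = den n r c2 (den n r c1 s1) by [].
have den_emit r c s1 : den n r (PEmit c) s1 = emit c s1 by [].
rewrite /emit_graph !den_seq !den_emit.
rewrite E1; last first.
  move=> i s' ni /= e; rewrite e; case: ifP => _; last by rewrite cats0 -e; case: (s').
  by rewrite /emit e cats1.
rewrite E2 //; last first.
  move=> i s' ni e; rewrite -[den _ _ _ _]/(if mat s' true i i then den n [:: i] (PFor (PIf true 1 1
             (PIf true 0 1 (PIf false 0 1 (PEmit true) (PEmit false)) (PEmit false))
             PSkip)) s' else s').
  rewrite e; case: ifP => _; last by rewrite cats0 -e; case: (s').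
  rewrite (@den_for_emit n [:: i] _ s' (fun j => if mat s true j j
     then [:: mat s true i j && mat s false i j] else [::])); first by rewrite e.
  move=> j s2 nj e2 /=; have e3 q x y : mat s2 q x y = mat s q x y by rewrite e2 e.
  rewrite !e3 -e2; case: (mat s true j j); last by rewrite cats0; case: (s2).
  by case: (mat s true i j); case: (mat s false i j); rewrite /= /emit cats1.
rewrite /= !flatten_if flatten_nseq -/us -!cats1 -!catA /=; congr (_ ++ _ :: _ ++ _ :: flatten _).
apply: eq_map => i; rewrite flatten_if -/us.
by elim: (us) => //= j l ->.
Qed.

End Steps.

Lemma nth_allpairs_pos (T U V : Type) (f : T -> U -> V) x0 x1 v0 s t i j :
  i < size s -> j < size t ->
  nth v0 [seq f x y | x <- s, y <- t] (i * size t + j) = f (nth x0 s i) (nth x1 t j).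
Proof.
elim: s i => // x s IH [|i] /= si tj; rewrite nth_cat size_map.
  by rewrite mul0n add0n tj (nth_map x1).
by rewrite mulSn -addnA ltnNge leq_addr /= addKn IH.
Qed.

Theorem theorem5p14 (R : realType) (a : nat) (ha : 1 <= a) :
  poly_time_reducible R a.
Proof.
(* The machine and its time bound depend on [a] only and are fixed before [G]. *)
have [p Hp] := prog_machineP (wf_reduction a).
exists (prog_machine (a + 4) (reduction a)), p => G aG; pose n := Defs.order G.
have n0 : 0 < n by exact: Defs.order_gt0.
pose b := [seq adj i j | i <- enum 'I_n, j <- enum 'I_n].
have sb : size b = n * n by rewrite size_allpairs size_enum_ord.
have := Hp n b n0 sb; rewrite -[nseq n true ++ _]/(encode G).
set s0 := loaded n b => comp.
pose s1 := den n [::] (fill_diag true true) s0.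
pose s2 := den n [::] (merge a) s1.
pose s3 := den n [::] (fill_diag false true) s2.
pose s4 := den n [::] compare_rows s3.
pose s5 := den n [::] check_diag s4.
pose s6 := den n [::] kill_twins s5.
pose s7 := den n [::] (fill_diag false false) s6.
have E : den n [::] (reduction a) s0 =
    if mat s5 false 0 0 then den n [::] emit_graph s7 else emit false s5 by [].
rewrite E in comp.
have [S1 O1] := den_fill_diag n true true s0; rewrite -/s1 in S1 O1.
pose A0 := mat s1 true.
(* Filling the diagonal turns the loaded adjacency matrix into [A_G + I]. *)
have A0E (i j : 'I_(Defs.order G)) : A0 i j = (i == j) || adj i j.
  rewrite /A0 S1 //= (inj_eq val_inj); case: eqP => //= _.
  rewrite -[n in (i * n)%N](size_enum_ord n) (nth_allpairs_pos _ i i) ?size_enum_ord //.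
  by rewrite !nth_ord_enum.
have B1 : below R a n A0 (mat s1 true).
  split=> // x y nx ny; rewrite -/A0.
  have := A0E (Ordinal nx) (Ordinal ny); have := A0E (Ordinal ny) (Ordinal nx).
  by rewrite /= => -> ->; rewrite eq_sym adj_sym.
have [[B21 B22 B23] D2 O2] := merge_below ha n0 B1; rewrite -/s2 in B21 B22 B23 D2 O2.
have cl : closed a n (mat s2 true) by apply: merge_closed.
set A := mat s2 true in B21 B22 B23 cl.
have [S3 O3] := den_fill_diag n false true s2; rewrite -/s3 in S3 O3.
have S3A x y : x < n -> mat s3 true x y = A x y by move=> nx; rewrite S3.
have [D4 A4 O4] := den_compare_rows n s3; rewrite -/s4 in D4 A4 O4.
have [D5 A5 O5] := den_check_diag n s4; rewrite -/s5 in D5 A5 O5.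
have tw x y : x < n -> y < n -> twin n (mat s3 true) x y = twin n A x y.
  by move=> nx ny; apply: eq_in_all => k _; rewrite !S3A.
have D3 x y : x < n -> y < n -> mat s3 false x y = (x == y).
  move=> nx ny; rewrite S3 //= D2 S1 //= /s0 /=.
  by case: eqP.
have out5 : out s5 = [::] by rewrite O5 O4 O3 O2 O1.
(* The flag shares a diagonal entry of the scratch matrix: it starts as 1 and is cleared only on
   rejection, when the scratch matrix is no longer consulted. *)
have f00 : mat s5 false 0 0 = all (fun i => A i i) (iota 0 n).
  rewrite D5 D4 // D3 //= A4; apply: eq_in_all => i; rewrite mem_iota => ni.
  exact: S3A.
have gA : gram R a n A0 <-> gram R a n A.
  split=> [[vs Hvs]|H]; first by exists vs; apply: B23.
  (* Deletion only lowers the bound, so vectors below the saturated matrix are below the original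
     one. *)
  by apply: (gram_map (f := id) H).
have th : theta_rank0 R G <-> gram R a n A0 by rewrite -aG; apply: theta_rank0P.
case fl: (mat s5 false 0 0) comp; rewrite f00 in fl; last first.
  rewrite /= out5 => comp; exists None; split=> //=.
  by rewrite th gA => gr; move/negP: fl; apply; apply/allP => i; rewrite mem_iota => ni; apply: (gram_diag gr).
have Ad i : i < n -> A i i by move=> ni; apply: (allP fl); rewrite mem_iota.
have A53 : mat s5 true = mat s3 true by rewrite A5 A4.
have D5E x y : x < n -> y < n -> mat s5 false x y = (x == y) || ~~ twin n (mat s5 true) x y.
  move=> nx ny; rewrite A53 D5 D4 // D3 //.
  suff -> : (x == 0) && (y == 0) ==> all (fun i => mat s4 true i i) (iota 0 n) by rewrite andbT.
  apply/implyP => _; apply/allP => i; rewrite mem_iota A4 => ni.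
  by rewrite S3A // Ad.
have Ad5 i : i < n -> mat s5 true i i by move=> ni; rewrite A53 S3A // Ad.
have [D6 O6 A6 ex6 un6] := den_kill_twins Ad5 D5E; rewrite -/s6 in D6 O6 A6 ex6 un6.
have [S7 O7] := den_fill_diag n false false s6; rewrite -/s7 in S7 O7.
rewrite den_emit_graph O7 O6 out5 /=.
set us := [seq _ <- _ | _] => comp.
have us_lt : all (gtn n) us.
  by apply/allP => u; rewrite mem_filter mem_iota => /andP[].
have us_uniq : uniq us by rewrite filter_uniq // iota_uniq.
have us_alive u : u \in us = (u < n) && mat s6 true u u.
  rewrite mem_filter mem_iota /= andbC; case: ltnP => //= nu.
  by rewrite S7.
have us_ex i : i < n -> exists2 u, u \in us & twin n A i u.
  move=> ni; have [u [nu ua tu]] := ex6 i ni; exists u; first by rewrite us_alive nu.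
  by rewrite -tw // -A53.
have us_twin u u' : u \in us -> u' \in us -> twin n A u u' -> u = u'.
  rewrite !us_alive => /andP[nu ua] /andP[nu' ua'] t; apply: un6 => //.
  by rewrite A53 tw.
pose H := quotient (erefl n) B22 us_lt us_ex.
exists (Some H); split; last first.
  rewrite -aG.
  have aG0 : 0 < alpha G by rewrite aG.
  apply: (quotient_correct (erefl n) aG0 A0E B22 Ad B21 _ _ us_uniq us_lt us_ex us_twin).
    rewrite aG => i j k S nS zS iS jS jk.
    by have /andP[] := cl i j k S nS zS iS jS jk.
  by rewrite aG.
rewrite (_ : encode_answer _ = true :: nseq (size us) true ++ false :: 
   [seq mat s7 true i j && mat s7 false i j | i <- us, j <- us]) //.
rewrite /= /encode /=; congr (_ :: _ ++ _ :: _).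
have usE : us = [seq nth 0 us (i : 'I_(size us)) | i <- enum 'I_(size us)].
  rewrite map_comp val_enum_ord.
  by rewrite -[LHS](mkseq_nth 0).
rewrite [in RHS]usE allpairs_mapl allpairs_mapr.
apply: eq_allpairs => i j; rewrite /quotient_adj.
have ui : nth 0 us i \in us by exact: mem_nth.
have uj : nth 0 us j \in us by exact: mem_nth.
have := ui; have := uj; rewrite !us_alive => /andP[nj aj] /andP[ni ai].
rewrite !S7 // D6 D5E //= (nth_uniq 0) //.
(* On the diagonal the cleared scratch entry makes the emitted bit 0. Elsewhere the scratch entry is
   1, as distinct survivors are not twins, so the entry of [A] is emitted. *)
have [->|ij] := eqVneq i j; rewrite ?eqxx ?andbF //=.
have nij : nth 0 us i != nth 0 us j by rewrite (nth_uniq 0).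
rewrite A6 // A53 S3A // tw // (inj_eq val_inj) (negPf ij) /= -[LHS]andbT.
congr (_ && _); apply/esym/negP => t.
by rewrite (us_twin _ _ ui uj t) eqxx in nij.
Qed.
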